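(* Let $A,B,C\in\mathbb{R}^{n\times n}$ be three matrices satisfying Assumptions A4, A5, A6 (see context), and such that $A$, $C$ and $\mathrm{offdiag}(B)$ are exactly-represented machine numbers. Denote by $S_k=\mathcal{F}^k(S_0)$ the result of performing $k$ steps of Cyclic Reduction (in exact arithmetic) starting from $S_0=(A,-\mathrm{offdiag}(B),-\mathrm{offdiag}(B),C)$, and by $\widetilde S_k=\widetilde{\mathcal F}^k(S_0)$ the result of $k$ steps of Cyclic Reduction performed in inexact machine arithmetic. Then $$|\widetilde S_k-S_k|\ \le\ n2^k\,(\psi(n)+n+2)\,\mathrm{u}\,S_k+O(\mathrm{u}^2),$$ where $\mathrm u$ is the machine precision and $\psi(n)=\frac23(2n+5)(n+2)(n+3)$.
   Context: Inequalities and absolute values are componentwise; $\mathbf 1,\mathbf 0$ are the all-ones and all-zeros vectors; $\mathrm{offdiag}(M)$ is the vector of the entries $M_{ij}$, $i\ne j$, in a fixed order. An M-matrix is $M=sI-P$ with $P\ge0$, $s\ge\rho(P)$. A triplet representation of $M$ is $(\mathrm{offdiag}(M),\mathbf v,\mathbf w)$ with $\mathbf v>\mathbf 0$, $\mathbf w\ge\mathbf 0$, $M\mathbf v=\mathbf w$. Assumptions: (A4) $A\ge0$, $C\ge0$, $B$ is an M-matrix. (A5) $(A-B+C)\mathbf 1=\mathbf 0$. (A6) The bi-infinite block tridiagonal matrix with diagonal blocks $-B$, superdiagonal blocks $C$ and subdiagonal blocks $A$ is irreducible and aperiodic (the directed graph of its nonzero entries is strongly connected with gcd of closed-walk lengths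 equal to 1). Cyclic Reduction: $A_0=A$, $B_0=\hat B_0=B$, $C_0=C$, and $A_{k+1}=A_kB_k^{-1}A_k$, $B_{k+1}=B_k-A_kB_k^{-1}C_k-C_kB_k^{-1}A_k$, $C_{k+1}=C_kB_k^{-1}C_k$, $\hat B_{k+1}=\hat B_k-C_kB_k^{-1}A_k$. Put $S_k=(A_k,-\mathrm{offdiag}(B_k),-\mathrm{offdiag}(\hat B_k),C_k)$, a 4-tuple of nonnegative matrices and vectors. $\mathcal F$ is the map with $S_{k+1}=\mathcal F(S_k)$: only off-diagonal entries of $B_k,\hat B_k$ are stored, and the M-matrix $B_k$ is reconstructed from its off-diagonal entries and the relation $B_k\mathbf 1=(A_k+C_k)\mathbf 1$. Inexact arithmetic: $\widetilde{\mathcal F}$ is the same step in floating-point arithmetic with the standard model $\mathrm{fl}(a\circ b)=(a\circ b)(1+\delta)$, $|\delta|\le \mathrm u$, where $B_k^{-1}A_k$ and $B_k^{-1}C_k$ are computed column by column by the subtraction-free GTH algorithm from the triplet representation $(\mathrm{offdiag}(B_k),\mathbf 1,(A_k+C_k)\mathbf 1)$ of $B_k$ (its accuracy guarantee being that the computed solution $\widetilde{\mathbf x}$ of $B_k\mathbf x=\mathbf b$, $\mathbf b\ge\mathbf 0$, satisfies $|\widetilde{\mathbf x}-\mathbf x|\le(\psi(n)\mathrm u+O(\mathrm u^2))\mathbf x$), the results are then multiplied by $A_k$ or $C_k$ on the left with ordinary matrix products, and the off-diagonal entries of $B_{k+1}$, $\hat B_{k+1}$ are obtained by ordinary additions. For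 4-tuples, $|\widetilde S-S|\le\alpha S+O(\mathrm u^2)$ means that the inequality holds for each of the four components (e.g. $|\widetilde A_k-A_k|\le\alpha A_k+O(\mathrm u^2)$, $|\mathrm{offdiag}(\widetilde B_k)-\mathrm{offdiag}(B_k)|\le\alpha|\mathrm{offdiag}(B_k)|+O(\mathrm u^2)$, and so on), the $O(\mathrm u^2)$ being as $\mathrm u\to0$ with the data and $k$ fixed. *)

(* Defs.v *)
From mathcomp Require Import all_boot all_order all_algebra.
From mathcomp Require Import complex.
From mathcomp Require Import classical_sets reals.

Set Implicit Arguments.
Unset Strict Implicit.
Unset Printing Implicit Defensive.

Import Order.TTheory GRing.Theory Num.Theory.
Local Open Scope ring_scope.

Section MMatrix.
Variable R : realType.

Definition nonneg_mx (m n : nat) (M : 'M[R]_(m, n)) : Prop :=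
  forall i j, 0 <= M i j.

Definition spectral_radius (n : nat) (P : 'M[R]_n) : R :=
  sup [set r : R | exists2 l : R[i],
         eigenvalue (map_mx (real_complex R) P) l & r = Normc.normc l]%classic.

Definition M_matrix (n : nat) (M : 'M[R]_n) : Prop :=
  exists (s : R) (P : 'M[R]_n),
    [/\ nonneg_mx P, spectral_radius P <= s & M = s%:M - P].

(* The vector of the entries M i j, i != j, is encoded as the matrix M with
   its diagonal replaced by zeros. *)
Definition offdiag (n : nat) (M : 'M[R]_n) : 'M[R]_n :=
  \matrix_(i, j) (if i == j then 0 else M i j).

Definition ones (n : nat) : 'cV[R]_n := const_mx 1.

End MMatrix.

Section BiInfinite.
Variables (R : realType) (n : nat).

(* Rows and columns of the bi-infinite matrix are indexed by pairs
   (block, position in the block). *)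
Definition biinf_index : Type := (int * 'I_n)%type.

Definition biinf_tridiag (A B C : 'M[R]_n) (x y : biinf_index) : R :=
  if y.1 == x.1 then - B x.2 y.2
  else if y.1 == x.1 + 1 then C x.2 y.2
  else if y.1 == x.1 - 1 then A x.2 y.2
  else 0.

End BiInfinite.

Section Graph.
Variables (R : realType) (T : Type) (M : T -> T -> R).

Definition nz_edge : rel T := fun x y => M x y != 0.

(* A walk from x to y of length l. *)
Definition walk (x y : T) (l : nat) : Prop :=
  exists p : seq T, [/\ path nz_edge x p, last x p = y & size p = l].

Definition irreducible_mx : Prop := forall x y : T, exists l, walk x y l.

(* 1 is the gcd of the lengths of all closed walks. *)
Definition aperiodic_mx : Prop :=
  forall d : nat, (forall x l, walk x x l -> (d %| l)%N) -> d = 1%N.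

End Graph.

Section Assumptions.
Variables (R : realType) (n : nat).

Definition assumption_A4 (A B C : 'M[R]_n) : Prop :=
  [/\ nonneg_mx A, nonneg_mx C & M_matrix B].

Definition assumption_A5 (A B C : 'M[R]_n) : Prop :=
  (A - B + C) *m ones R n = 0.

Definition assumption_A6 (A B C : 'M[R]_n) : Prop :=
  irreducible_mx (biinf_tridiag A B C) /\ aperiodic_mx (biinf_tridiag A B C).

End Assumptions.

Section CyclicReduction.
Variables (R : realType) (n : nat).

Record cr_data := CRData {
  crA : 'M[R]_n; crB : 'M[R]_n; crBhat : 'M[R]_n; crC : 'M[R]_n }.

Definition cr_step (X : cr_data) : cr_data :=
  let: CRData A B Bhat C := X in
  CRData (A *m invmx B *m A)
         (B - A *m invmx B *m C - C *m invmx B *m A)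
         (Bhat - C *m invmx B *m A)
         (C *m invmx B *m C).

(* The stored 4-tuple (A, - offdiag B, - offdiag Bhat, C). *)
Record cr_state := CRState {
  stA : 'M[R]_n; stP : 'M[R]_n; stPhat : 'M[R]_n; stC : 'M[R]_n }.

Definition cr_store (X : cr_data) : cr_state :=
  CRState (crA X) (- offdiag (crB X)) (- offdiag (crBhat X)) (crC X).

(* The matrix M with - offdiag M = offdiag P and M 1 = w. *)
Definition mx_of_triplet (P : 'M[R]_n) (w : 'cV[R]_n) : 'M[R]_n :=
  \matrix_(i, j) (if i == j then w i 0 + \sum_(l | l != i) P i l else - P i j).

(* The diagonal of Bhat is not stored; it has no influence on the
   off-diagonal entries produced by a step, and is set to 0 here. *)
Definition cr_load (S : cr_state) : cr_data :=
  CRData (stA S) (mx_of_triplet (stP S) ((stA S + stC S) *m ones R n))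
         (- offdiag (stPhat S)) (stC S).

Definition cr_map (S : cr_state) : cr_state := cr_store (cr_step (cr_load S)).

(* |S' - S| <= a S + e, in each of the four components. *)
Definition state_close (a e : R) (S' S : cr_state) : Prop :=
  let close (M' M : 'M[R]_n) := forall i j, `|M' i j - M i j| <= a * M i j + e in
  [/\ close (stA S') (stA S), close (stP S') (stP S),
      close (stPhat S') (stPhat S) & close (stC S') (stC S)].

End CyclicReduction.

Section FloatingPoint.
Variable R : realType.

(* [sum_by add s r]: r is obtained by adding up the terms of s with
   [size s - 1] calls to [add], in an arbitrary order. *)
Inductive sum_by (add : R -> R -> R) : seq R -> R -> Prop :=
| SumNil : sum_by add [::] 0
| SumOne x : sum_by add [:: x] x
| SumAdd s x y t r :
    perm_eq s [:: x, y & t] -> sum_by add (add x y :: t) r -> sum_by add s r.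

Definition std_model (u : R) (computed exact : R) : Prop :=
  exists2 delta : R, `|delta| <= u & computed = exact * (1 + delta).

(* Floating-point arithmetic with machine precision u. [fl_num] is the set of
   machine numbers; [fl_sum] performs the ordinary summation of a list, in an
   order which is left unspecified. *)
Record fl_arith (u : R) := FlArith {
  fl_num : R -> Prop;
  fl_add : R -> R -> R;
  fl_mul : R -> R -> R;
  fl_div : R -> R -> R;
  fl_sum : seq R -> R;
  fl_num0 : fl_num 0;
  fl_numN : forall a, fl_num a -> fl_num (- a);
  fl_addP : forall a b, fl_num a -> fl_num b ->
    fl_num (fl_add a b) /\ std_model u (fl_add a b) (a + b);
  fl_mulP : forall a b, fl_num a -> fl_num b ->
    fl_num (fl_mul a b) /\ std_model u (fl_mul a b) (a * b);
  fl_divP : forall a b, fl_num a -> fl_num b -> b != 0 ->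
    fl_num (fl_div a b) /\ std_model u (fl_div a b) (a / b);
  fl_sumP : forall s, sum_by fl_add s (fl_sum s) }.

Variables (u : R) (F : fl_arith u).

(* GTH algorithm: subtraction-free Gaussian elimination for M x = b, where M
   is given by its triplet representation (- P, 1, w) (the diagonal of P is
   never read) and b >= 0. Products with the entries 1 of the second component
   are omitted. The pivot is recovered from the row sum as
   w_0 + \sum_(j > 0) P_0j; elimination of the first unknown updates the
   triplet and the right-hand side, and the first unknown is obtained last, by
   back substitution. *)
Fixpoint fl_gth (n : nat) : 'M[R]_n -> 'cV[R]_n -> 'cV[R]_n -> 'cV[R]_n :=
  match n with
  | 0 => fun _ _ _ => 0
  | m.+1 => fun P w b =>
      let up := lift (@ord0 m) in
      let pivot := fl_sum F (w ord0 0 :: [seq P ord0 (up j) | j <- enum 'I_m]) in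
      let mult i := fl_div F (P (up i) ord0) pivot in
      let P' := \matrix_(i, j)
        (if i == j then 0
         else fl_add F (P (up i) (up j)) (fl_mul F (mult i) (P ord0 (up j)))) in
      let w' := \col_i fl_add F (w (up i) 0) (fl_mul F (mult i) (w ord0 0)) in
      let b' := \col_i fl_add F (b (up i) 0) (fl_mul F (mult i) (b ord0 0)) in
      let x' := fl_gth P' w' b' in
      let x0 := fl_div F
        (fl_sum F (b ord0 0 :: [seq fl_mul F (P ord0 (up j)) (x' j 0) | j <- enum 'I_m]))
        pivot in
      \col_i (if unlift ord0 i is Some j then x' j 0 else x0)
  end.

Variable n : nat.

Definition fl_mulmx (M N : 'M[R]_n) : 'M[R]_n :=
  \matrix_(i, j) fl_sum F [seq fl_mul F (M i l) (N l j) | l <- enum 'I_n].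

Definition fl_solve (P : 'M[R]_n) (w : 'cV[R]_n) (N : 'M[R]_n) : 'M[R]_n :=
  \matrix_(i, j) fl_gth P w (col j N) i 0.

Definition fl_cr_map (S : cr_state R n) : cr_state R n :=
  let: CRState A P Phat C := S in
  let w := \col_i fl_sum F [seq fl_add F (A i j) (C i j) | j <- enum 'I_n] in
  let XA := fl_solve P w A in
  let XC := fl_solve P w C in
  let AXC := fl_mulmx A XC in
  let CXA := fl_mulmx C XA in
  CRState (fl_mulmx A XA)
    (\matrix_(i, j) if i == j then 0
                    else fl_sum F [:: P i j; AXC i j; CXA i j])
    (\matrix_(i, j) if i == j then 0 else fl_add F (Phat i j) (CXA i j))
    (fl_mulmx C XC).

Definition machine_mx (M : 'M[R]_n) : Prop := forall i j, fl_num F (M i j).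

End FloatingPoint.

Definition psi (R : realType) (n : nat) : R :=
  2 / 3 * (2 * n%:R + 5) * (n%:R + 2) * (n%:R + 3).

Arguments cr_map {R n} S.
Arguments fl_cr_map {R u} F {n} S.

(* Main.v *)
Require Import Defs.
From HB Require Import structures.
From mathcomp Require Import all_boot all_order all_algebra.
From mathcomp Require Import reals.
From mathcomp Require Import ring lra zify.
Set Implicit Arguments.
Unset Strict Implicit.
Unset Printing Implicit Defensive.
Import Order.TTheory GRing.Theory Num.Theory.
Local Open Scope ring_scope.

(** Why the bound holds.  No step of the algorithm subtracts, so rounding
errors can be followed multiplicatively: with [rho = 1 / (1 - u)], each
floating-point operation moves a nonnegative number by at most one factor
[rho] up or down ([near]), and such exponents just add up.  The [O(u^2)] term
appears only at the very end, when [rho ^+ N - 1] is expanded to first order.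

Everything rests on one perturbation lemma ([solution_near]).  A triplet
representation describes the system
  [\sum_l P i l * (x i - x l) + w i * x i = b i];
if the nonnegative data [P], [w], [b] of [d] of its rows are moved by a factor
[rho] each, the solution moves by at most [rho ^+ (2 * d)].  Indeed, as a
function of the data of a single row the solution is a quotient of two linear
forms with nonnegative coefficients, so that row contributes one factor [rho]
for the numerator and one for the denominator; the rows are changed one after
the other.

This is used three times.
- In Gaussian elimination, one elimination step is a perturbation by
  [rho ^+ (m + 3)] of the triplet of a Schur complement of size [m], hence costs
  [2 * m * (m + 3)]; summing over the steps gives [gth_err], about [2/3 n^3].
- The computed row sums [(A + C) 1] are off by [rho ^+ n], which costs
  [2 * n * n] more in the solution.
- For the propagation of errors through [j] steps of cyclic reduction, these
  are not treated one by one, which would give an exponent growing like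
  [(2 n + 1) ^ j].  Cyclic reduction eliminates the odd blocks of a block
  tridiagonal system, so after [j] steps [A], [C] and the corrections to [B] and
  [Bhat] are read off the solutions of the original system on [2 ^ j - 1]
  consecutive blocks ([transfer_matrices]).  The perturbation lemma for these
  [n (2 ^ j - 1)] rows, together with the final product by [A] or [C], yields
  the exponent [2 n (2 ^ j - 1) + 1] ([cr_iter_sensitivity]).

The local error [step_err] of each of the [k] steps is amplified by the latter
exponent, and the sum of these is at most [2 n 2 ^ k] times [step_err].  Finally
[2 * step_err <= psi n + n + 2] ([step_err_le]): both sides have the leading
terms [4/3 n^3 + 10 n^2], and the remaining ones are larger on the right.

Solvability at every stage, for exact and perturbed data alike, comes from the
irreducibility assumption, in the form that no nonempty set of unknowns of any
finite section is closed, which depends on the zero pattern only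
([transient], [good]). *)

(** * Multiplicative closeness *)

Section Near.
Variables (R : realType) (rho : R).
Hypothesis rho_ge1 : 1 <= rho.

(** Nonnegativity of both numbers is included: for [rho > 1] it follows from the
two inequalities, but not for [rho = 1]. *)
Definition near (e : nat) (a b : R) : Prop :=
  [/\ 0 <= a, 0 <= b, a <= rho ^+ e * b & b <= rho ^+ e * a].

Lemma rhoX_ge1 e : 1 <= rho ^+ e.
Proof. exact: exprn_ege1. Qed.

Lemma rhoX_ge0 e : 0 <= rho ^+ e.
Proof. exact: le_trans (rhoX_ge1 e). Qed.

Lemma near_refl e a : 0 <= a -> near e a a.
Proof. by move=> a0; split=> //; rewrite ler_peMl ?rhoX_ge1. Qed.

Lemma near_sym e a b : near e a b -> near e b a.
Proof. by case=> *; split. Qed.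

Lemma near_weaken e e' a b : (e <= e')%N -> near e a b -> near e' a b.
Proof.
move=> le_e [a0 b0 ab ba].
by split=> //; [apply: le_trans ab _ | apply: le_trans ba _];
  rewrite ler_wpM2r // ler_weXn2l.
Qed.

Lemma near_trans e f b a c : near e a b -> near f b c -> near (e + f) a c.
Proof.
case=> a0 b0 ab ba [_ c0 bc cb]; split=> //.
  by apply: le_trans ab _; rewrite exprD -mulrA ler_wpM2l ?rhoX_ge0.
by apply: le_trans cb _; rewrite addnC exprD -mulrA ler_wpM2l ?rhoX_ge0.
Qed.

Lemma near_eq0 e a b : near e a b -> (a == 0) = (b == 0).
Proof.
case=> a0 b0 ab ba; apply/eqP/eqP=> h; apply/eqP; rewrite eq_le.
  by rewrite b0 andbT (le_trans ba) // h mulr0.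
by rewrite a0 andbT (le_trans ab) // h mulr0.
Qed.

Lemma near_add e a b c d : near e a b -> near e c d -> near e (a + c) (b + d).
Proof.
case=> a0 b0 ab ba [c0 d0 cd dc].
by split; rewrite ?addr_ge0 // mulrDr lerD.
Qed.

Lemma near_mul e f a b c d :
  near e a b -> near f c d -> near (e + f) (a * c) (b * d).
Proof.
case=> a0 b0 ab ba [c0 d0 cd dc].
by split; rewrite ?mulr_ge0 // exprD mulrACA ler_pM // mulr_ge0 ?rhoX_ge0.
Qed.

Lemma near_inv e a b : near e a b -> near e a^-1 b^-1.
Proof.
move=> ab; have := near_eq0 ab; case: (eqVneq b 0) => [->|b0] h.
  by rewrite (eqP h); apply: near_refl; rewrite invr0.
have {}h : a != 0 by rewrite h.
case: ab => age0 bge0 ab ba; split; rewrite ?invr_ge0 //.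
  rewrite -ler_pdivrMl; last exact: lt_le_trans (rhoX_ge1 e).
  rewrite -invfM lef_pV2 ?posrE ?lt0r ?b0 ?bge0 //.
  by rewrite mulf_eq0 negb_or h gt_eqF ?(lt_le_trans _ (rhoX_ge1 e)) // mulr_ge0 // rhoX_ge0.
rewrite -ler_pdivrMl; last exact: lt_le_trans (rhoX_ge1 e).
rewrite -invfM lef_pV2 ?posrE ?lt0r ?h ?age0 //.
by rewrite mulf_eq0 negb_or b0 gt_eqF ?(lt_le_trans _ (rhoX_ge1 e)) // mulr_ge0 // rhoX_ge0.
Qed.

Lemma near_div e f a b c d :
  near e a b -> near f c d -> near (e + f) (a / c) (b / d).
Proof. by move=> ab cd; apply: near_mul => //; apply: near_inv. Qed.

Lemma near_sum e (I : Type) (r : seq I) (p : pred I) (F G : I -> R) :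
  (forall i, p i -> near e (F i) (G i)) ->
  near e (\sum_(i <- r | p i) F i) (\sum_(i <- r | p i) G i).
Proof.
move=> FG; elim/big_rec2: _ => [|i y1 y2 pi ih]; first exact: near_refl.
by apply: near_add => //; apply: FG.
Qed.

Lemma near_dist e a b : near e a b -> `|a - b| <= (rho ^+ e - 1) * b.
Proof.
case=> a0 b0 ab ba; have r1 := rhoX_ge1 e.
have hb : 0 <= (rho ^+ e - 1) * b by rewrite mulr_ge0 // subr_ge0.
rewrite ler_norml; apply/andP; split; last by lra.
have [leab|ltab] := leP a b; last by lra.
have : (rho ^+ e - 1) * a <= (rho ^+ e - 1) * b by rewrite ler_wpM2l // subr_ge0.
lra.
Qed.

End Near.

(** Turns closeness to the power [m] into a single step for the parameter
[rho ^+ m], the form in which perturbation results are stated. *)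
Lemma near_exp (R : realType) (rho : R) m e a b :
  near rho (m * e) a b <-> near (rho ^+ m) e a b.
Proof. by rewrite /near exprM. Qed.

(** * Systems in triplet form and their sensitivity *)

Section ExactSystems.
Variables (R : realType) (T : finType).
Implicit Types (P : T -> T -> R) (w x y : T -> R) (U : {set T}).

(** The value at [i] of the M-matrix with off-diagonal part [- P] and row sums
[w], applied to [x].  Written with differences, it does not read the diagonal of
[P], and the maximum principle becomes visible. *)
Definition balance P w x (i : T) : R := \sum_l P i l * (x i - x l) + w i * x i.

(** In terms of a Markov chain with jump rates [P] and killing rates [w], there is
no closed set of states without killing.  This is the combinatorial form of
the nonsingularity of the M-matrix, which a change of the data inside its zero
pattern cannot destroy. *)
Definition transient P w : Prop :=
  forall U, (forall i, i \in U -> w i = 0 /\ forall l, l \notin U -> P i l = 0) ->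
    U = set0.

Lemma balance_linear P w a x y i :
  balance P w (fun l => a * x l + y l) i = a * balance P w x i + balance P w y i.
Proof.
rewrite /balance [in RHS]mulrDr [in RHS]mulr_sumr addrACA -big_split /=.
congr (_ + _); last by ring.
by apply: eq_bigr => l _; ring.
Qed.

Lemma balance_sub P w a x y i :
  balance P w (fun l => a * x l - y l) i = a * balance P w x i - balance P w y i.
Proof.
rewrite /balance [in RHS]mulrDr [in RHS]mulr_sumr opprD addrACA -sumrN -big_split /=.
by congr (_ + _); [apply: eq_bigr => l _; ring | ring].
Qed.

Lemma balance_eq P P' w w' x x' i :
  (forall l, l != i -> P i l = P' i l) -> w i = w' i -> x =1 x' ->
  balance P w x i = balance P' w' x' i.
Proof.
move=> eqP eqw eqx; rewrite /balance eqw eqx; congr (_ + _).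
apply: eq_bigr => l _; rewrite !eqx.
by have [->|/eqP->//] := eqVneq l i; rewrite subrr !mulr0.
Qed.

(** At a negative minimum all terms of the balance are nonpositive, hence zero,
so the set of minimizers is closed.  The alternative [0 <= y i] allows some
rows to be replaced by a sign condition on the unknown. *)
Lemma min_principle P w y :
  (forall i l, 0 <= P i l) -> (forall i, 0 <= w i) -> transient P w ->
  (forall i, 0 <= balance P w y i \/ 0 <= y i) -> forall i, 0 <= y i.
Proof.
move=> P0 w0 tr hy i0; have [//|yi0] := leP 0 (y i0).
have [i1 _ ymin] := @Order.TotalTheory.arg_minP _ _ _ i0 predT y isT.
have mu0 : y i1 < 0 by apply: le_lt_trans yi0; apply: ymin.
suff /setP/(_ i1) : [set i | y i == y i1] = set0 by rewrite !inE eqxx.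
apply: tr => i; rewrite inE => /eqP yi.
have gi : 0 <= balance P w y i by case: (hy i) => //; rewrite yi leNgt mu0.
have s0 : \sum_l P i l * (y i - y l) <= 0.
  by apply: sumr_le0 => l _; rewrite mulr_ge0_le0 // yi subr_le0 ymin.
have w0' : w i * y i <= 0 by rewrite mulr_ge0_le0 // yi ltW.
have /eqP : w i * y i = 0 by move: gi; rewrite /balance; lra.
rewrite mulf_eq0 yi (lt_eqF mu0) orbF => /eqP wi0; split=> // l.
rewrite inE => yl.
have /eqP : \sum_l P i l * (y l - y i) = 0.
  apply/eqP; rewrite -oppr_eq0 -sumrN; apply/eqP.
  under eq_bigr do rewrite -mulrN opprB.
  by move: gi; rewrite /balance wi0; lra.
rewrite psumr_eq0; last by move=> k _; rewrite mulr_ge0 // subr_ge0 yi ymin.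
move=> /allP/(_ l (mem_index_enum _)) /=; rewrite mulf_eq0 subr_eq0 yi (negPf yl) orbF.
by move/eqP.
Qed.

Lemma balance_solution_ge0 P w x :
  (forall i l, 0 <= P i l) -> (forall i, 0 <= w i) -> transient P w ->
  (forall i, 0 <= balance P w x i) -> forall i, 0 <= x i.
Proof. by move=> P0 w0 tr h; apply: (min_principle P0 w0 tr) => i; left. Qed.

Lemma balance_inj P w x y :
  (forall i l, 0 <= P i l) -> (forall i, 0 <= w i) -> transient P w ->
  balance P w x =1 balance P w y -> x =1 y.
Proof.
move=> P0 w0 tr exy.
have h a b : balance P w a =1 balance P w b -> forall i, a i <= b i.
  move=> eab i; have := @balance_solution_ge0 P w (fun l => -1 * a l + b l) P0 w0 tr.
  move=> /(_ _ i); rewrite mulN1r addrC subr_ge0; apply=> l.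
  by rewrite balance_linear eab mulN1r addNr.
by move=> i; apply/eqP; rewrite eq_le !h // => l; rewrite exy.
Qed.

(** Converse of the minimum principle: the negated indicator function of a closed
set has a nonnegative balance. *)
Lemma transient_of_monotone P w :
  (forall i l, 0 <= P i l) ->
  (forall y, (forall i, 0 <= balance P w y i) -> forall i, 0 <= y i) -> transient P w.
Proof.
move=> P0 mono U cl; apply/setP => i; rewrite inE; apply/negP => iU.
have := mono (fun l => - (l \in U)%:R) _ i; rewrite iU oppr_ge0 ler10.
move=> h; suff: false by []; apply: h => {iU} {}i.
rewrite /balance; case iU: (i \in U).
  have [-> Pi] := cl i iU; rewrite mul0r addr0 big1 // => l _.
  by case lU: (l \in U); rewrite ?subrr ?mulr0 // Pi ?lU // mul0r.
rewrite oppr0 mulr0 addr0 sumr_ge0 // => l _.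
by rewrite mulr_ge0 // sub0r opprK ler0n.
Qed.

Lemma transient_pattern P P' w w' :
  (forall i l, P' i l = 0 -> P i l = 0) -> (forall i, w' i = 0 -> w i = 0) ->
  transient P w -> transient P' w'.
Proof.
move=> eP ew tr U cl; apply: tr => i /cl[wi Pi].
by split=> [|l /Pi]; [apply: ew | apply: eP].
Qed.

(** An injective endomorphism of a finite-dimensional space is onto. *)
Lemma balance_solvable P w (b : T -> R) :
  (forall i l, 0 <= P i l) -> (forall i, 0 <= w i) -> transient P w ->
  exists x, balance P w x =1 b.
Proof.
move=> P0 w0 tr.
pose f (v : {ffun T -> R^o}) : {ffun T -> R^o} := [ffun i => balance P w v i].
have flin : linear f.
  move=> a u v; apply/ffunP => i; rewrite !ffunE.
  by rewrite -[RHS]balance_linear; apply: balance_eq => // l; rewrite !ffunE.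
pose fL := GRing.isLinear.Build _ _ _ _ f flin.
pose fM : {linear _ -> _} := HB.pack f fL.
have ker0 : lker (linfun fM) == 0%VS.
  apply/eqP/vspaceP => v; rewrite memv_ker memv0 lfunE /=.
  apply/eqP/eqP => [fv0|->]; last exact: (linear0 fM).
  apply/ffunP => i; rewrite ffunE.
  apply: (@balance_inj P w v (fun=> 0)) => // l.
  move/ffunP/(_ l): fv0; rewrite !ffunE => ->.
  by rewrite /balance mulr0 addr0 big1 // => k _; rewrite subrr mulr0.
pose c : {ffun T -> R^o} := [ffun i => b i].
have : c \in limg (linfun fM) by rewrite (lker0_limgf ker0) memvf.
case/memv_imgP => v _; rewrite lfunE /= => /ffunP e.
by exists v => i; move: (e i); rewrite !ffunE.
Qed.

Variable rho : R.
Hypothesis rho_ge1 : 1 <= rho.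

Lemma transient_near e P P' w w' :
  (forall i l, near rho e (P' i l) (P i l)) -> (forall i, near rho e (w' i) (w i)) ->
  transient P w -> transient P' w'.
Proof.
move=> eP ew; apply: transient_pattern => [i l|i] /eqP h; apply/eqP.
  by rewrite -(near_eq0 (eP i l)).
by rewrite -(near_eq0 (ew i)).
Qed.

(** Only row [r] changes.  The other rows determine the solution up to its value
at [r]: [x = z + x r * g] with [g] the probability of reaching [r] and [z] the
solution that vanishes at [r], both independent of row [r].  Substituting this
in row [r] gives [x r] as a quotient of two linear forms with nonnegative
coefficients in the data of that row. *)
Lemma solution_row_le P P' w w' b b' x x' r :
  (forall i l, near rho 1 (P' i l) (P i l)) ->
  (forall i, near rho 1 (w' i) (w i)) -> (forall i, near rho 1 (b' i) (b i)) ->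
  (forall i, i != r -> [/\ P' i =1 P i, w' i = w i & b' i = b i]) ->
  transient P w -> balance P w x =1 b -> balance P' w' x' =1 b' ->
  forall i, x' i <= rho ^+ 2 * x i.
Proof.
move=> nP nw nb eq_r tr gx gx'.
have tr' := transient_near nP nw tr.
have P0 i l : 0 <= P i l by case: (nP i l).
have w0 i : 0 <= w i by case: (nw i).
have P'0 i l : 0 <= P' i l by case: (nP i l).
have w'0 i : 0 <= w' i by case: (nw i).
have b0 i : 0 <= b i by case: (nb i).
have b'0 i : 0 <= b' i by case: (nb i).
have x0 : forall i, 0 <= x i.
  by apply: (balance_solution_ge0 P0 w0 tr) => i; rewrite gx.
have x'0 : forall i, 0 <= x' i.
  by apply: (balance_solution_ge0 P'0 w'0 tr') => i; rewrite gx'.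
have gx'r i : i != r -> balance P w x' i = b i.
  by move=> ir; case: (eq_r i ir) => eP ew <-; rewrite -gx'; apply: balance_eq.
have r21 : 1 <= rho ^+ 2 by exact: rhoX_ge1.
have row_r : x' r <= rho ^+ 2 * x r.
  rewrite leNgt; apply/negP => ltr.
  have d0 : 0 < x' r - x r.
    by rewrite subr_gt0; apply: le_lt_trans ltr; rewrite ler_peMl.
  set d := x' r - x r in d0.
  (* As x and x' solve the same rows i != r, the function g is obtained as their
     normalized difference. *)
  pose g i : R := d^-1 * (x' i + -1 * x i).
  have gE i : x' i = d * g i + x i.
    by rewrite /g mulrA divff ?gt_eqF //; ring.
  have gr1 : g r = 1 by rewrite /g mulN1r mulVf ?gt_eqF.
  have balance_g i : i != r -> balance P w g i = 0.
    move=> ir; have := gx'r i ir.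
    rewrite (@balance_eq _ P _ w _ (fun l => d * g l + x l)) // balance_linear gx.
    by move/eqP; rewrite -subr_eq0 addrK mulf_eq0 gt_eqF // => /eqP.
  have g_ge0 : forall i, 0 <= g i.
    apply: (min_principle P0 w0 tr) => i.
    by have [->|/balance_g->] := eqVneq i r; [right; rewrite gr1 | left].
  have balance1 i : balance P w (fun=> 1) i = w i.
    by rewrite /balance mulr1 big1 ?add0r // => l _; rewrite subrr mulr0.
  have g_le1 i : 0 <= 1 - g i.
    suff: 0 <= -1 * g i + 1 by lra.
    move: i; apply: (min_principle P0 w0 tr) => i.
    have [->|ir] := eqVneq i r; first by right; rewrite gr1; lra.
    by left; rewrite balance_linear balance1 balance_g // mulr0 add0r.
  pose z i : R := - x r * g i + x i.
  have z_ge0 : forall i, 0 <= z i.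
    apply: (min_principle P0 w0 tr) => i.
    have [->|ir] := eqVneq i r; first by right; rewrite /z gr1; lra.
    by left; rewrite balance_linear gx balance_g // mulr0 add0r.
  have xE i : x i = z i + x r * g i by rewrite /z; ring.
  have x'E i : x' i = z i + x' r * g i by rewrite gE /z /d; ring.
  pose D (Q : T -> T -> R) (v : T -> R) : R := \sum_l Q r l * (1 - g l) + v r.
  pose N (Q : T -> T -> R) (c : T -> R) : R := c r + \sum_l Q r l * z l.
  (* Row r, after elimination of the other unknowns. *)
  have row_balance Q v c (y : T -> R) :
      balance Q v y r = c r -> (forall i, y i = z i + y r * g i) ->
      y r * D Q v = N Q c.
    move=> gy yE; rewrite /D /N -gy /balance mulrDr addrAC -big_split /=.
    rewrite mulr_sumr [y r * v r]mulrC; congr (_ + _); apply: eq_bigr => l _.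
    by rewrite [y l]yE; ring.
  have eD := row_balance P w b x (gx r) xE.
  have eD' := row_balance P' w' b' x' (gx' r) x'E.
  have nD : near rho 1 (D P' w') (D P w).
    apply: near_add => //; apply: near_sum => // l _.
    by rewrite -[1%N]addn0; apply: near_mul => //; apply: near_refl.
  have nN : near rho 1 (N P' b') (N P b).
    apply: near_add => //; apply: near_sum => // l _.
    by rewrite -[1%N]addn0; apply: near_mul => //; apply: near_refl.
  have D'pos : 0 < D P' w'.
    rewrite lt0r; apply/andP; split; last by case: nD.
    apply/eqP => D0.
    have gg i : balance P' w' g i = 0.
      have [->|ir] := eqVneq i r; last first.
        by rewrite -(balance_g i ir); case: (eq_r i ir) => *; apply: balance_eq.
      by rewrite /balance gr1 mulr1.
    have g0 : g =1 fun=> 0.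
      apply: (balance_inj P'0 w'0 tr') => i; rewrite gg.
      by rewrite /balance mulr0 addr0 big1 // => l _; rewrite subrr mulr0.
    by have := oner_neq0 R; rewrite -gr1 g0 eqxx.
  case: nN nD => _ _ nN _ [_ _ _ nD].
  have : x' r * D P' w' <= rho ^+ 2 * x r * D P' w'.
    rewrite eD' (le_trans nN) // -eD expr1 expr2 -!mulrA ler_wpM2l ?(le_trans ler01) //.
    by rewrite mulrCA ler_wpM2l.
  by rewrite ler_pM2r // leNgt ltr.
suff h i : 0 <= rho ^+ 2 * x i - x' i by move=> i; rewrite -subr_ge0.
move: i; apply: (min_principle P0 w0 tr) => i.
have [->|ir] := eqVneq i r; first by right; lra.
by left; rewrite balance_sub gx gx'r // subr_ge0 ler_peMl.
Qed.

Lemma solution_row_near P P' w w' b b' x x' r :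
  (forall i l, near rho 1 (P' i l) (P i l)) ->
  (forall i, near rho 1 (w' i) (w i)) -> (forall i, near rho 1 (b' i) (b i)) ->
  (forall i, i != r -> [/\ P' i =1 P i, w' i = w i & b' i = b i]) ->
  transient P w -> balance P w x =1 b -> balance P' w' x' =1 b' ->
  forall i, near rho 2 (x' i) (x i).
Proof.
move=> nP nw nb eq_r tr gx gx' i.
have tr' := transient_near nP nw tr.
split.
- apply: (@balance_solution_ge0 P' w') => // [k l|k|k]; first by case: (nP k l).
    by case: (nw k).
  by rewrite gx'; case: (nb k).
- apply: (@balance_solution_ge0 P w) => // [k l|k|k]; first by case: (nP k l).
    by case: (nw k).
  by rewrite gx; case: (nb k).
- exact: (solution_row_le nP nw nb eq_r).
- apply: (@solution_row_le P' P w' w b' b _ _ r) => // [k l|k|k|k kr].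
  + exact: near_sym.
  + exact: near_sym.
  + exact: near_sym.
  + by case: (eq_r k kr) => eP -> ->; split=> // l; rewrite eP.
Qed.

(** One factor [rho ^+ 2] for each row of [W], changing one row at a time. *)
Lemma solution_near (W : {set T}) P P' w w' b b' x x' :
  (forall i l, near rho 1 (P' i l) (P i l)) ->
  (forall i, near rho 1 (w' i) (w i)) -> (forall i, near rho 1 (b' i) (b i)) ->
  (forall i, i \notin W -> [/\ P' i =1 P i, w' i = w i & b' i = b i]) ->
  transient P w -> balance P w x =1 b -> balance P' w' x' =1 b' ->
  forall i, near rho (2 * #|W|) (x' i) (x i).
Proof.
move cW : #|W| => c; elim: c => [|c IH] in W cW P w b x *.
  move=> nP nw nb eqW tr gx gx' i.
  have {}eqW k : [/\ P' k =1 P k, w' k = w k & b' k = b k].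
    by apply: eqW; rewrite (cards0_eq cW) inE.
  have P0 k l : 0 <= P k l by case: (nP k l).
  have w0 k : 0 <= w k by case: (nw k).
  have -> : x' i = x i.
    apply: (balance_inj P0 w0 tr) => k; rewrite gx; case: (eqW k) => eP ew <-.
    by rewrite -gx'; apply: balance_eq => // l; rewrite eP.
  apply: near_refl => //; apply: (@balance_solution_ge0 P w) => // k.
  by rewrite gx; case: (nb k).
have [r rW] : exists r, r \in W by apply/set0Pn; rewrite -card_gt0 cW.
move=> nP nw nb eqW tr gx gx' i.
(* An intermediate system, with row r already changed. *)
pose Q k := if k == r then P' k else P k.
pose v k := if k == r then w' k else w k.
pose a k := if k == r then b' k else b k.
have P0 k l : 0 <= P k l by case: (nP k l).
have w0 k : 0 <= w k by case: (nw k).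
have b0 k : 0 <= b k by case: (nb k).
have P'0 k l : 0 <= P' k l by case: (nP k l).
have w'0 k : 0 <= w' k by case: (nw k).
have b'0 k : 0 <= b' k by case: (nb k).
have nQ k l : near rho 1 (Q k l) (P k l).
  by rewrite /Q; case: eqP => // _; apply: near_refl.
have nv k : near rho 1 (v k) (w k).
  by rewrite /v; case: eqP => // _; apply: near_refl.
have na k : near rho 1 (a k) (b k).
  by rewrite /a; case: eqP => // _; apply: near_refl.
have trQ := transient_near nQ nv tr.
have [y gy] : exists y, balance Q v y =1 a.
  apply: balance_solvable => // [k l|k]; first by case: (nQ k l).
  by case: (nv k).
have -> : (2 * c.+1 = 2 * c + 2)%N by rewrite mulnSr.
apply: (@near_trans _ _ _ _ _ (y i)) => //.
  apply: (IH (W :\ r) _ Q v a) => // [|k l|k|k|k].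
  - by move: (cardsD1 r W); rewrite rW cW => -[].
  - by rewrite /Q; case: eqP => // _; apply: near_refl.
  - by rewrite /v; case: eqP => // _; apply: near_refl.
  - by rewrite /a; case: eqP => // _; apply: near_refl.
  - rewrite !inE /Q /v /a; case: eqP => //= _; exact: eqW.
apply: (solution_row_near nQ nv na (r := r)) => // k /negPf kr.
by rewrite /Q /v /a kr.
Qed.

End ExactSystems.

(** * Errors of elementary floating-point operations *)

Section FloatingPointErrors.
Variables (R : realType) (u : R) (F : fl_arith u).
Hypothesis u_gt0 : 0 < u.
Hypothesis u_lt1 : u < 1.

Notation rho := (1 - u)^-1.
Notation num := (fl_num F).

Lemma rho_ge1 : 1 <= rho.
Proof. by rewrite invf_ge1 ?subr_gt0 // gerBl ltW. Qed.
Local Hint Resolve rho_ge1 : core.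

Lemma std_model_near c e : 0 <= e -> std_model u c e -> near rho 1 c e.
Proof.
move=> e0 [d]; rewrite ler_norml => /andP[du ud] ->.
have d1 : 0 <= 1 + d by move: u_lt1; lra.
split; rewrite ?mulr_ge0 // expr1 mulrC.
  rewrite ler_wpM2r // -[_^-1]mul1r ler_pdivlMr ?subr_gt0 //.
  have : 0 <= (u - d) + u * d by nra.
  lra.
rewrite ler_pdivlMr ?subr_gt0 // ler_wpM2l //; lra.
Qed.

Lemma fl_add_near a b : num a -> num b -> 0 <= a -> 0 <= b ->
  num (fl_add F a b) /\ near rho 1 (fl_add F a b) (a + b).
Proof.
move=> na nb a0 b0; case: (fl_addP na nb) => ? h; split=> //.
by apply: std_model_near; rewrite ?addr_ge0.
Qed.

Lemma fl_mul_near a b : num a -> num b -> 0 <= a -> 0 <= b ->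
  num (fl_mul F a b) /\ near rho 1 (fl_mul F a b) (a * b).
Proof.
move=> na nb a0 b0; case: (fl_mulP na nb) => ? h; split=> //.
by apply: std_model_near; rewrite ?mulr_ge0.
Qed.

Lemma fl_div_near a b : num a -> num b -> 0 <= a -> 0 < b ->
  num (fl_div F a b) /\ near rho 1 (fl_div F a b) (a / b).
Proof.
move=> na nb a0 b0; have bn0 : b != 0 by rewrite gt_eqF.
case: (fl_divP na nb bn0) => ? h; split=> //.
by apply: std_model_near; rewrite ?divr_ge0 // ltW.
Qed.

(** Whatever the order of the additions, each term goes through at most
[size s - 1] of them. *)
Lemma sum_by_near s r : sum_by (fl_add F) s r ->
  (forall x, x \in s -> num x /\ 0 <= x) ->
  num r /\ near rho (size s).-1 r (\sum_(x <- s) x).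
Proof.
elim=> [|x|{}s x y t {}r perm_s _ IH] hs.
- by rewrite big_nil; split; [exact: fl_num0 | exact: near_refl].
- have [nx x0] := hs x (mem_head _ _).
  by rewrite big_seq1; split=> //; apply: near_refl.
have [nx x0] : num x /\ 0 <= x by apply: hs; rewrite (perm_mem perm_s) !inE eqxx.
have [ny y0] : num y /\ 0 <= y by apply: hs; rewrite (perm_mem perm_s) !inE eqxx orbT.
have ht z : z \in t -> num z /\ 0 <= z.
  by move=> zt; apply: hs; rewrite (perm_mem perm_s) !inE zt !orbT.
have [nxy xy] := fl_add_near nx ny x0 y0.
have [z|nr near_r] := IH.
  by rewrite inE => /predU1P[->|/ht//]; split=> //; case: xy.
split=> //; rewrite (perm_size perm_s) (perm_big _ perm_s) /= !big_cons addrA.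
have -> : (size t).+1 = ((size (fl_add F x y :: t)).-1 + 1)%N by rewrite addn1.
apply: (near_trans rho_ge1 near_r); rewrite big_cons; apply: near_add => //.
apply: near_refl => //; rewrite big_seq sumr_ge0 // => z zt.
by case: (ht z zt).
Qed.

Lemma fl_sum_near e (I : Type) (s : seq I) (f g : I -> R) :
  (forall i, num (f i) /\ near rho e (f i) (g i)) ->
  num (fl_sum F [seq f i | i <- s]) /\
  near rho (e + (size s).-1) (fl_sum F [seq f i | i <- s]) (\sum_(i <- s) g i).
Proof.
move=> fg; have [|nr near_r] := sum_by_near (fl_sumP F [seq f i | i <- s]).
  elim: s => [|i s IH] x //=; rewrite inE => /predU1P[->|/IH//].
  by have [? []] := fg i.
split=> //; rewrite addnC; move: near_r; rewrite size_map big_map => near_r.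
by apply: (near_trans _ near_r) => //; apply: near_sum => // i _; case: (fg i).
Qed.

End FloatingPointErrors.

(** * Elimination of one unknown *)

Section Elimination.
Variables (R : realType) (m : nat).
Implicit Types (P : 'I_m.+1 -> 'I_m.+1 -> R) (w x : 'I_m.+1 -> R).

Notation up := (lift (@ord0 m)).

(** The diagonal entry of row 0, recovered without subtraction. *)
Definition pivot P w : R := w ord0 + \sum_j P ord0 (up j).

(** Off-diagonal part of the Schur complement; its diagonal is irrelevant and is set
to 0, as in the GTH algorithm. *)
Definition schurP P w (i j : 'I_m) : R :=
  if i == j then 0 else P (up i) (up j) + P (up i) ord0 / pivot P w * P ord0 (up j).

Definition schur_vec P w (v : 'I_m.+1 -> R) (i : 'I_m) : R :=
  v (up i) + P (up i) ord0 / pivot P w * v ord0.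

Lemma balance_ord0 P w x :
  balance P w x ord0 = pivot P w * x ord0 - \sum_j P ord0 (up j) * x (up j).
Proof.
rewrite /balance /pivot big_ord_recl subrr mulr0 add0r mulrDl mulr_suml.
under eq_bigr do rewrite mulrBr.
by rewrite sumrB; ring.
Qed.

(** Adding the multiple [P (up i) ord0 / pivot] of row 0 to row [up i] cancels the
unknown [x ord0]; the updates of the row sums and of the right-hand side are
the same linear operation. *)
Lemma balance_schur P w x i : pivot P w != 0 ->
  balance (schurP P w) (schur_vec P w w) (fun j => x (up j)) i =
  schur_vec P w (balance P w x) i.
Proof.
move=> p0; set c := P (up i) ord0 / pivot P w.
rewrite (@balance_eq _ _ _
  (fun i j => P (up i) (up j) + P (up i) ord0 / pivot P w * P ord0 (up j))
  _ (schur_vec P w w) _ (fun j => x (up j))) //; last first.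
  by move=> l il; rewrite /schurP eq_sym (negPf il).
rewrite /schur_vec balance_ord0 /balance big_ord_recl -/c.
have -> : P (up i) ord0 = c * pivot P w by rewrite /c divfK.
rewrite /pivot.
under eq_bigr do rewrite mulrDl.
rewrite big_split /=.
have -> : \sum_j c * P ord0 (up j) * (x (up i) - x (up j)) =
   c * (\sum_j P ord0 (up j)) * x (up i) - c * \sum_j P ord0 (up j) * x (up j).
  rewrite -mulrA mulr_suml -mulrBr -sumrB mulr_sumr.
  by apply: eq_bigr => j _; ring.
by ring.
Qed.

Lemma pivot_gt0 P w : (forall i j, 0 <= P i j) -> (forall i, 0 <= w i) ->
  transient P w -> 0 < pivot P w.
Proof.
move=> P0 w0 tr; have S0 : 0 <= \sum_j P ord0 (up j) by rewrite sumr_ge0.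
rewrite lt0r addr_ge0 // andbT; apply/negP; rewrite paddr_eq0 // => /andP[/eqP w00].
rewrite psumr_eq0 // => /allP PS.
have /setP/(_ ord0) : [set @ord0 m] = set0.
  apply: tr => i; rewrite inE => /eqP->; split=> // l; rewrite inE.
  case: (unliftP ord0 l) => [j ->|->]; last by rewrite eqxx.
  by move=> _; apply/eqP; exact: (PS j (mem_index_enum _)).
by rewrite !inE eqxx.
Qed.

(** A vector with nonnegative balance for the Schur complement extends, by solving
row 0 for the eliminated unknown, to one for the full system. *)
Lemma schur_transient P w : (forall i j, 0 <= P i j) -> (forall i, 0 <= w i) ->
  transient P w -> transient (schurP P w) (schur_vec P w w).
Proof.
move=> P0 w0 tr; have p0 := pivot_gt0 P0 w0 tr.
apply: transient_of_monotone => [i j|y hy i].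
  by rewrite /schurP; case: ifP => // _; rewrite addr_ge0 // mulr_ge0 // divr_ge0 // ltW.
pose y0 := (\sum_j P ord0 (up j) * y j) / pivot P w.
pose x k := if unlift ord0 k is Some j then y j else y0.
have xup j : x (up j) = y j by rewrite /x liftK.
have x0 : x ord0 = y0 by rewrite /x unlift_none.
have gx0 : balance P w x ord0 = 0.
  rewrite balance_ord0 x0 /y0 mulrC divfK ?gt_eqF //.
  by rewrite (eq_bigr _ (fun j _ => congr1 _ (xup j))) subrr.
rewrite -xup; apply: (balance_solution_ge0 P0 w0 tr) => k.
case: (unliftP ord0 k) => [j ->|->]; last by rewrite gx0.
have := hy j; rewrite -(@balance_eq _ _ (schurP P w) _ (schur_vec P w w) _ (fun j => x (up j))) //.
by rewrite balance_schur ?gt_eqF // /schur_vec gx0 mulr0 addr0.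
Qed.

End Elimination.

(** * Accuracy of the GTH algorithm *)

(** Exponent of the error of the GTH algorithm.  The term [2 * m * (m + 3)] is the
effect on the remaining [m] unknowns of the errors in the updated triplet and
right-hand side ([m + 3] rounding errors in each datum), and [2 * m.+1] is the
cost of the back substitution for the eliminated unknown. *)
Fixpoint gth_err (n : nat) : nat :=
  if n is m.+1 then (gth_err m + 2 * m * (m + 3) + 2 * m.+1)%N else 0%N.

Section GTH.
Variables (R : realType) (u : R) (F : fl_arith u).
Hypothesis u_gt0 : 0 < u.
Hypothesis u_lt1 : u < 1.

Notation rho := (1 - u)^-1.
Notation num := (fl_num F).

Lemma fl_gth_near n (P : 'M[R]_n) (w b : 'cV[R]_n) (x : 'I_n -> R) :
  (forall i j, num (P i j) /\ 0 <= P i j) ->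
  (forall i, num (w i 0) /\ 0 <= w i 0) -> (forall i, num (b i 0) /\ 0 <= b i 0) ->
  transient P (w^~ 0) -> balance P (w^~ 0) x =1 b^~ 0 ->
  forall i, num (fl_gth F P w b i 0) /\
    near rho (gth_err n) (fl_gth F P w b i 0) (x i).
Proof.
have r1 := rho_ge1 u_gt0 u_lt1.
elim: n => [|m IH] in P w b x *; first by move=> _ _ _ _ _ [].
move=> hP hw hb tr gx.
have P0 i j : 0 <= P i j by case: (hP i j).
have w0 i : 0 <= w i 0 by case: (hw i).
have b0 i : 0 <= b i 0 by case: (hb i).
have nP i j : num (P i j) by case: (hP i j).
have nw i : num (w i 0) by case: (hw i).
have nb i : num (b i 0) by case: (hb i).
have p0 := pivot_gt0 P0 w0 tr.
move=> i; rewrite [fl_gth _ _ _ _]/=; move: i.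
set up := lift ord0; set piv := fl_sum F _.
pose mult i := fl_div F (P (up i) ord0) piv.
set P1 := (X in fl_gth F X _ _); set w1 := (X in fl_gth F _ X _).
set b1 := (X in fl_gth F _ _ X); set x1 := fl_gth F P1 w1 b1.
have [npiv near_piv] : num piv /\ near rho m piv (pivot P (w^~ 0)).
  have [|np] := sum_by_near u_gt0 u_lt1
      (fl_sumP F (w ord0 0 :: [seq P ord0 (up j) | j <- enum 'I_m])).
    by move=> y; rewrite inE => /predU1P[->//|/mapP[j _ ->]].
  by rewrite /= size_map size_enum_ord big_cons big_map big_enum.
have piv0 : 0 < piv.
  by rewrite lt0r (near_eq0 near_piv) gt_eqF //=; case: near_piv.
have hmult i : num (mult i) /\ near rho m.+1 (mult i) (P (up i) ord0 / pivot P (w^~ 0)).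
  have [nm near_m] := fl_div_near u_lt1 (nP (up i) ord0) npiv (P0 _ _) piv0.
  split=> //; rewrite -[X in near _ X]add1n; apply: (near_trans r1 near_m).
  by rewrite -[X in near _ X]add0n; apply: near_div => //; apply: near_refl.
have update a i v : num a -> 0 <= a -> num v -> 0 <= v ->
    num (fl_add F a (fl_mul F (mult i) v)) /\
    near rho (m + 3) (fl_add F a (fl_mul F (mult i) v))
      (a + P (up i) ord0 / pivot P (w^~ 0) * v).
  move=> na a0 nv v0; have [nm near_m] := hmult i.
  have m0 : 0 <= mult i by case: near_m.
  have [nmv near_mv] := fl_mul_near u_lt1 nm nv m0 v0.
  have mv0 : 0 <= fl_mul F (mult i) v by case: near_mv.
  have [ns near_s] := fl_add_near u_lt1 na nmv a0 mv0.
  split=> //; have -> : (m + 3 = 1 + (1 + m.+1))%N by lia.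
  apply: (near_trans r1 near_s); apply: near_add; first exact: near_refl.
  apply: (near_trans r1 near_mv); rewrite -[X in near _ X]addn0.
  by apply: near_mul => //; apply: near_refl.
have hP1 i j : num (P1 i j) /\ near rho (m + 3) (P1 i j) (schurP P (w^~ 0) i j).
  rewrite mxE /schurP; case: eqP => _; last by apply: update.
  by split; [exact: fl_num0 | exact: near_refl].
have hw1 i : num (w1 i 0) /\ near rho (m + 3) (w1 i 0) (schur_vec P (w^~ 0) (w^~ 0) i).
  by rewrite mxE; apply: update.
have hb1 i : num (b1 i 0) /\ near rho (m + 3) (b1 i 0) (schur_vec P (w^~ 0) (b^~ 0) i).
  by rewrite mxE; apply: update.
have trS := schur_transient P0 w0 tr.
have tr1 : transient P1 (w1^~ 0).
  apply: (transient_near (rho := rho) (e := m + 3) _ _ trS) => [i j|i].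
    by case: (hP1 i j).
  by case: (hw1 i).
have P10 i j : 0 <= P1 i j by case: (hP1 i j) => _ [].
have w10 i : 0 <= w1 i 0 by case: (hw1 i) => _ [].
have b10 i : 0 <= b1 i 0 by case: (hb1 i) => _ [].
have [y gy] := balance_solvable (b1^~ 0) P10 w10 tr1.
(* The errors of this elimination step, seen as a perturbation of the data
   of the Schur complement. *)
have near_y j : near rho (2 * m * (m + 3)) (y j) (x (up j)).
  rewrite mulnC; apply/near_exp; rewrite -[X in (_ * X)%N]card_ord -cardsT.
  apply: (@solution_near _ _ _ (rhoX_ge1 r1 (m + 3)) setT
    (schurP P (w^~ 0)) P1 (schur_vec P (w^~ 0) (w^~ 0))
    (w1^~ 0) (schur_vec P (w^~ 0) (b^~ 0)) (b1^~ 0)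
    (fun j => x (up j)) y) => //.
  - by move=> k l; apply/near_exp; rewrite muln1; case: (hP1 k l).
  - by move=> k; apply/near_exp; rewrite muln1; case: (hw1 k).
  - by move=> k; apply/near_exp; rewrite muln1; case: (hb1 k).
  - by move=> k; rewrite inE.
  - by move=> k; rewrite (balance_schur x) ?gt_eqF // /schur_vec !gx.
have hx1 j : num (x1 j 0) /\ near rho (gth_err m + 2 * m * (m + 3)) (x1 j 0) (x (up j)).
  have [||| nx near_x] := IH P1 w1 b1 y _ _ _ tr1 gy j.
  - by move=> k l; case: (hP1 k l).
  - by move=> k; case: (hw1 k).
  - by move=> k; case: (hb1 k).
  by split=> //; apply: (near_trans r1 near_x).
move=> i; rewrite mxE; case: (unliftP ord0 i) => [j|] ->; rewrite ?liftK ?unlift_none /=.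
  have [nx near_x] := hx1 j; split=> //; apply: near_weaken near_x => //; lia.
set num0 := fl_sum F _.
have xE : x ord0 = (b ord0 0 + \sum_j P ord0 (up j) * x (up j)) / pivot P (w^~ 0).
  by rewrite -(gx ord0) balance_ord0 subrK mulrC mulKf // gt_eqF.
have hterm j : num (fl_mul F (P ord0 (up j)) (x1 j 0)) /\
   near rho (gth_err m + 2 * m * (m + 3) + 1) (fl_mul F (P ord0 (up j)) (x1 j 0))
     (P ord0 (up j) * x (up j)).
  have [nx near_x] := hx1 j.
  have [|nt near_t] := fl_mul_near u_lt1 (nP ord0 (up j)) nx (P0 _ _) _.
    by case: near_x.
  split=> //; rewrite addnC; apply: (near_trans r1 near_t).
  by rewrite -[X in near _ X]add0n; apply: near_mul => //; apply: near_refl.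
have [nnum0 near_num0] : num num0 /\ near rho (gth_err m + 2 * m * (m + 3) + 1 + m) num0
    (b ord0 0 + \sum_j P ord0 (up j) * x (up j)).
  have [|np] := sum_by_near u_gt0 u_lt1
      (fl_sumP F (b ord0 0 :: [seq fl_mul F (P ord0 (up j)) (x1 j 0) | j <- enum 'I_m])).
    move=> z; rewrite inE => /predU1P[->//|/mapP[j _ ->]].
    by have [? []] := hterm j.
  rewrite /= size_map size_enum_ord big_cons big_map big_enum => near_s.
  split=> //; rewrite addnC; apply: (near_trans r1 near_s).
  apply: near_add; first exact: near_refl.
  by apply: near_sum => // j _; case: (hterm j).
have [|nx near_x] := fl_div_near u_lt1 nnum0 npiv _ piv0.
  by case: near_num0.
split=> //; rewrite xE.
have -> : (gth_err m + 2 * m * (m + 3) + 2 * m.+1 =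
  1 + (gth_err m + 2 * m * (m + 3) + 1 + m + m))%N by lia.
by apply: (near_trans r1 near_x); apply: near_div.
Qed.

End GTH.

(** * Cyclic reduction as elimination of odd blocks *)

Section CyclicReductionTheory.
Variables (R : realType) (n : nat).
Implicit Types (S : cr_state R n) (M N : 'M[R]_n) (x y : nat -> 'cV[R]_n).

Lemma offdiagE M i j : offdiag M i j = if i == j then 0 else M i j.
Proof. by rewrite mxE. Qed.

Definition row_sums S : 'cV[R]_n := (stA S + stC S) *m ones R n.
(** The M-matrix [B] reconstructed from the stored off-diagonal entries. *)
Definition full_mx S : 'M[R]_n := mx_of_triplet (stP S) (row_sums S).

Definition valid_state S : Prop :=
  [/\ nonneg_mx (stA S), nonneg_mx (stC S),
      nonneg_mx (stP S) /\ offdiag (stP S) = stP S &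
      nonneg_mx (stPhat S) /\ offdiag (stPhat S) = stPhat S].

Lemma row_sumsE S i : row_sums S i 0 = \sum_k (stA S i k + stC S i k).
Proof. by rewrite !mxE; apply: eq_bigr => k _; rewrite !mxE mulr1. Qed.

Lemma mulmx_triplet (P : 'M[R]_n) (w v : 'cV[R]_n) i :
  (mx_of_triplet P w *m v) i 0 = balance P (w^~ 0) (v^~ 0) i.
Proof.
rewrite mxE /balance [LHS](bigD1 i) //= [in RHS](bigD1 i) //= mxE eqxx subrr mulr0 add0r.
rewrite mulrDl mulr_suml -addrA addrC; congr (_ + _).
rewrite -big_split /=; apply: eq_bigr => k ki.
by rewrite mxE eq_sym (negPf ki); ring.
Qed.

Lemma colM M N j : col j (M *m N) = M *m col j N.
Proof. by apply/matrixP => i k; rewrite !mxE; apply: eq_bigr => l _; rewrite mxE. Qed.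

Definition interior (m p : nat) : bool := (0 < p < m)%N.

(** Off-diagonal rates of the section with blocks [0, ..., m] of the block
tridiagonal system, with Dirichlet conditions in the two extreme blocks: these
have no rates and, by [dirichlet], row sum 1, so that their equations
prescribe the boundary values.  Keeping the boundary blocks as unknowns avoids
special equations in the blocks next to them. *)
Definition tridiag S m (t s : 'I_m.+1 * 'I_n) : R :=
  if interior m t.1 then
    (s.1 == t.1)%:R * stP S t.2 s.2
    + (s.1 == t.1.+1 :> nat)%:R * stC S t.2 s.2
    + (s.1 == t.1.-1 :> nat)%:R * stA S t.2 s.2
  else 0.

Definition dirichlet m (t : 'I_m.+1 * 'I_n) : R := (~~ interior m t.1)%:R.

(** The equation of the block [l], for a sequence of blocks of unknowns; only
meaningful for [0 < l]. *)
Definition residual S x (l : nat) : 'cV[R]_n :=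
  full_mx S *m x l - stA S *m x l.-1 - stC S *m x l.+1.

Lemma residualS S x l :
  residual S x l.+1 = full_mx S *m x l.+1 - stA S *m x l - stC S *m x l.+2.
Proof. by []. Qed.

Definition harmonic S (m : nat) x : Prop :=
  forall l, interior m l -> residual S x l = 0.

Lemma sum_delta m (f : nat -> R) v : (v <= m)%N ->
  \sum_(q < m.+1) (q == v :> nat)%:R * f q = f v.
Proof.
move=> vm; rewrite (bigD1 (inord v)) //= inordK // eqxx mul1r big1 ?addr0 // => q.
by rewrite -val_eqE /= inordK // => /negPf->; rewrite mul0r.
Qed.

Lemma balance_tridiag S m x t :
  balance (@tridiag S m) (@dirichlet m) (fun s => x s.1 s.2 0) t =
  if interior m t.1 then residual S x t.1 t.2 0 else x t.1 t.2 0.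
Proof.
case: t => p i; rewrite /balance /tridiag /dirichlet /=.
case: ifP => int; last first.
  by rewrite mul1r big1 ?add0r // => s _; rewrite mul0r.
rewrite mul0r addr0 -(pair_bigA _ (fun q k => ((q == p)%:R * stP S i k +
  (q == p.+1 :> nat)%:R * stC S i k + (q == p.-1 :> nat)%:R * stA S i k)
  * (x p i 0 - x q k 0))) /=.
pose f M (q : nat) := \sum_k M i k * (x p i 0 - x q k 0).
under eq_bigr => q _.
  under eq_bigr do rewrite !mulrDl -!mulrA.
  rewrite !big_split -!mulr_sumr -/(f (stP S) q) -/(f (stC S) q) -/(f (stA S) q).
  over.
have /andP[p0 pm] := int.
rewrite !big_split /= !sum_delta ?(ltnW pm) ?pm //; last first.
  exact: leq_trans (leq_pred p) (ltnW pm).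
rewrite /residual /f [in RHS]mxE [in RHS]mxE mulmx_triplet /balance row_sumsE.
rewrite !mxE -!addrA; congr (_ + _).
rewrite mulr_suml -!sumrN -!big_split /=; apply: eq_bigr => k _; ring.
Qed.

(** What is needed for all later steps of cyclic reduction to be well defined.
Step [j] inverts a Schur complement of the section of length [2 ^ j.+1], hence
the quantification over all lengths. *)
Definition good S : Prop :=
  valid_state S /\ forall m, transient (@tridiag S m) (@dirichlet m).

Lemma valid_P0 S : valid_state S -> forall i j, 0 <= stP S i j.
Proof. by case=> _ _ []. Qed.

Lemma valid_w0 S : valid_state S -> forall i, 0 <= row_sums S i 0.
Proof. by case=> A0 C0 _ _ i; rewrite row_sumsE sumr_ge0 // => k _; rewrite addr_ge0. Qed.

Lemma tridiag_ge0 S m : valid_state S -> forall t s, 0 <= @tridiag S m t s.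
Proof.
by case=> A0 C0 [P0 _] _ t s; rewrite /tridiag; case: ifP => // _;
  rewrite !addr_ge0 // mulr_ge0.
Qed.

Lemma dirichlet_ge0 m t : 0 <= @dirichlet m t.
Proof. by rewrite ler0n. Qed.

(** [B] itself is the section with a single interior block. *)
Lemma good_transient S : good S -> transient (stP S) ((row_sums S)^~ 0).
Proof.
case=> -[A0 C0 [P0 _] _] tr U cl.
suff UT : [set t : 'I_3 * 'I_n | (t.1 == 1%N :> nat) && (t.2 \in U)] = set0.
  apply/setP => i; move/setP/(_ (inord 1, i)): UT.
  by rewrite !inE /= inordK.
apply: (tr 2) => -[p i] /=; rewrite inE /= => /andP[/eqP p1 iU].
rewrite /dirichlet /tridiag /= p1; split=> // -[q k]; rewrite inE /=.
have [/eqP wi Pi] := cl i iU.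
rewrite row_sumsE psumr_eq0 in wi; last by move=> l _; rewrite addr_ge0.
have /eqP := allP wi k (mem_index_enum _).
move/eqP; rewrite paddr_eq0 // => /andP[/eqP-> /eqP->].
rewrite -val_eqE /= p1 !mulr0 !addr0.
by case: eqP => [_ /= kU|_ _]; rewrite ?mul0r // Pi // mulr0.
Qed.

Lemma triplet_unit (P : 'M[R]_n) (w : 'cV[R]_n) :
  nonneg_mx P -> (forall i, 0 <= w i 0) -> transient P (w^~ 0) ->
  mx_of_triplet P w \in unitmx.
Proof.
move=> P0 w0 tr.
have [X XP] := fin_all_exists (fun j : 'I_n =>
  balance_solvable (fun i => (i == j)%:R) P0 w0 tr).
suff /mulmx1_unit[] : mx_of_triplet P w *m (\matrix_(i, j) X j i) = 1%:M by [].
apply/matrixP => i j; transitivity (col j (mx_of_triplet P w *m \matrix_(i, j) X j i) i 0).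
  by rewrite [RHS]mxE.
rewrite colM mulmx_triplet mxE -XP; apply: balance_eq => // k.
by rewrite !mxE.
Qed.

Definition solve_mx S M : 'M[R]_n := invmx (full_mx S) *m M.

Lemma good_unit S : good S -> full_mx S \in unitmx.
Proof.
move=> gS; have [vS _] := gS; case: (vS) => _ _ [P0 _] _.
by apply: triplet_unit => //; [exact: valid_w0 | exact: good_transient].
Qed.

Lemma solve_mx_balance S M j : good S ->
  balance (stP S) ((row_sums S)^~ 0) (fun i => solve_mx S M i j) =1 (fun i => M i j).
Proof.
move=> gS i; have := mulmx_triplet (stP S) (row_sums S) (col j (solve_mx S M)) i.
rewrite -/(full_mx S) -colM /solve_mx mulmxA mulmxV ?good_unit // mul1mx mxE => ->.
by apply: balance_eq => // k; rewrite !mxE.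
Qed.

Lemma solve_mx_ge0 S M : good S -> nonneg_mx M -> nonneg_mx (solve_mx S M).
Proof.
move=> gS M0 i j; have [vS _] := gS; move: i.
apply: (balance_solution_ge0 (valid_P0 vS) (valid_w0 vS) (good_transient gS)) => i.
by rewrite solve_mx_balance.
Qed.

Lemma mulmx_ge0 M N : nonneg_mx M -> nonneg_mx N -> nonneg_mx (M *m N).
Proof. by move=> M0 N0 i j; rewrite mxE sumr_ge0 // => k _; rewrite mulr_ge0. Qed.

Lemma addmx_ge0 M N : nonneg_mx M -> nonneg_mx N -> nonneg_mx (M + N).
Proof. by move=> M0 N0 i j; rewrite mxE addr_ge0. Qed.

Lemma cr_mapA S : stA (cr_map S) = stA S *m solve_mx S (stA S).
Proof. by rewrite /solve_mx mulmxA. Qed.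

Lemma cr_mapC S : stC (cr_map S) = stC S *m solve_mx S (stC S).
Proof. by rewrite /solve_mx mulmxA. Qed.

Lemma cr_mapP S : stP (cr_map S) =
  offdiag (stP S + stA S *m solve_mx S (stC S) + stC S *m solve_mx S (stA S)).
Proof.
apply/matrixP => i j; rewrite /solve_mx !mulmxA -/(full_mx S) !mxE.
by case: eqP => _; rewrite ?oppr0 // !opprD !opprK.
Qed.

Lemma cr_mapPhat S : stPhat (cr_map S) = offdiag (stPhat S + stC S *m solve_mx S (stA S)).
Proof.
apply/matrixP => i j; rewrite /solve_mx !mulmxA -/(full_mx S) !mxE.
by case: eqP => _; rewrite ?oppr0 // !opprD !opprK.
Qed.

Lemma offdiag_ge0 M : nonneg_mx M -> nonneg_mx (offdiag M).
Proof. by move=> M0 i j; rewrite offdiagE; case: ifP. Qed.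

Lemma offdiag_idem M : offdiag (offdiag M) = offdiag M.
Proof. by apply/matrixP => i j; rewrite !mxE; case: eqP. Qed.

Lemma offdiagD M N : offdiag (M + N) = offdiag M + offdiag N.
Proof. by apply/matrixP => i j; rewrite !mxE; case: eqP; rewrite ?addr0. Qed.

Lemma valid_cr_map S : good S -> valid_state (cr_map S).
Proof.
move=> gS; have [[A0 C0 [P0 _] [Q0 _]] _] := gS.
rewrite /valid_state cr_mapA cr_mapC cr_mapP cr_mapPhat !offdiag_idem.
have AX M : nonneg_mx M -> nonneg_mx (stA S *m solve_mx S M).
  by move=> M0; apply: mulmx_ge0 => //; apply: solve_mx_ge0.
have CX M : nonneg_mx M -> nonneg_mx (stC S *m solve_mx S M).
  by move=> M0; apply: mulmx_ge0 => //; apply: solve_mx_ge0.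
split; [exact: AX | exact: CX | split=> // | split=> //]; apply: offdiag_ge0.
  by apply: addmx_ge0; [apply: addmx_ge0 => //; exact: AX | exact: CX].
by apply: addmx_ge0 => //; exact: CX.
Qed.

Lemma mx_of_triplet_offdiag M (w : 'cV[R]_n) :
  M *m ones R n = w -> mx_of_triplet (- offdiag M) w = M.
Proof.
move=> <-; apply/matrixP => i j; rewrite !mxE; case: eqP => [<-|/eqP ij].
  rewrite (bigD1 i) //= !mxE mulr1 -addrA -big_split /= big1 ?addr0 // => l li.
  by rewrite !mxE eq_sym (negPf li) mulr1 subrr.
by rewrite opprK.
Qed.

Lemma full_mx_ones S : full_mx S *m ones R n = row_sums S.
Proof.
apply/matrixP => i j; rewrite ord1 mulmx_triplet /balance big1 => [|k _].
  by rewrite add0r /ones [const_mx _ _ _]mxE mulr1.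
by rewrite !mxE subrr mulr0.
Qed.

(** The step recomputes the diagonal of [B] from the row sums, and this agrees with
the formula for [B_{k+1}], because the recurrences preserve the relation
[B 1 = (A + C) 1]: one has [B^-1 A 1 + B^-1 C 1 = 1]. *)
Lemma full_mx_cr_map S : good S ->
  full_mx (cr_map S) = full_mx S - stA S *m solve_mx S (stC S) - stC S *m solve_mx S (stA S).
Proof.
move=> gS; have uB := good_unit gS.
have stP' : stP (cr_map S) =
    - offdiag (full_mx S - stA S *m solve_mx S (stC S) - stC S *m solve_mx S (stA S)).
  by rewrite /solve_mx !mulmxA.
rewrite /full_mx stP'; apply: mx_of_triplet_offdiag.
rewrite !mulmxBl full_mx_ones /row_sums cr_mapA cr_mapC !mulmxDl -!mulmxA.
have e : solve_mx S (stA S) *m ones R n + solve_mx S (stC S) *m ones R n = ones R n.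
  by rewrite /solve_mx -!mulmxA -mulmxDr -mulmxDl -/(row_sums S) -full_mx_ones mulKmx.
have cancel (a b c d : 'cV[R]_n) : a + b + (c + d) - b - c = a + d.
  by apply/matrixP => i j; rewrite !mxE; ring.
by rewrite -{1 2}e !mulmxDr !mulmxA cancel.
Qed.

(** If the equations of the two neighbouring odd blocks hold, eliminating these
blocks turns the equation of an even block into that of the reduced system. *)
Lemma residual_double S x l : good S ->
  residual S x l.*2.+1 = 0 -> residual S x l.*2.+3 = 0 ->
  residual (cr_map S) (fun l => x l.*2) l.+1 = residual S x l.+1.*2.
Proof.
rewrite !doubleS !residualS !doubleS => gS e1 e3.
have solve q : full_mx S *m x q.+1 - stA S *m x q - stC S *m x q.+2 = 0 ->
    x q.+1 = solve_mx S (stA S) *m x q + solve_mx S (stC S) *m x q.+2.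
  move/eqP; rewrite -addrA -opprD subr_eq0 => /eqP h.
  by rewrite /solve_mx -!mulmxA -mulmxDr -h mulKmx // good_unit.
rewrite full_mx_cr_map // cr_mapA cr_mapC (solve _ e1) (solve _ e3).
rewrite !mulmxBl !mulmxDr !mulmxA.
by apply/matrixP => i j; rewrite !mxE; ring.
Qed.

(** Back substitution: the odd blocks recovered from the even ones. *)
Definition refine S y (l : nat) : 'cV[R]_n :=
  if odd l then solve_mx S (stA S) *m y l./2 + solve_mx S (stC S) *m y l./2.+1 else y l./2.

Lemma refine_even S y l : refine S y l.*2 = y l.
Proof. by rewrite /refine odd_double doubleK. Qed.

Lemma refine_odd S y l : good S -> residual S (refine S y) l.*2.+1 = 0.
Proof.
move=> gS; rewrite residualS -doubleS !refine_even /refine /= odd_double /=.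
rewrite uphalf_double /solve_mx -!mulmxA -mulmxDr mulmxA mulmxV ?good_unit // mul1mx.
by apply/matrixP => i j; rewrite !mxE; ring.
Qed.

Lemma harmonic_ge0 S m x : good S ->
  (forall l i, interior m l -> 0 <= residual S x l i 0) ->
  (forall i, 0 <= x 0%N i 0) -> (forall i, 0 <= x m i 0) ->
  forall l i, (l <= m)%N -> 0 <= x l i 0.
Proof.
move=> [vS tr] hres x0 xm l i lm.
have := @balance_solution_ge0 _ _ _ _ (fun s : 'I_m.+1 * 'I_n => x s.1 s.2 0)
  (@tridiag_ge0 S m vS) (@dirichlet_ge0 m) (tr m) _ (inord l, i).
rewrite /= inordK //; apply=> -[p k]; rewrite balance_tridiag /=.
case: ifP => [/hres//|/negbT]; rewrite negb_and -leqNgt leqn0 -leqNgt.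
case/orP => [/eqP->//|mp]; suff -> : p = m :> nat by [].
by apply/eqP; rewrite eqn_leq mp -ltnS ltn_ord.
Qed.

(** The section of length [m] of the reduced system embeds by [refine] in the
section of length [2 m] of the original one, with the same residuals at the even
blocks and zero residuals at the odd ones; the minimum principle is thus
inherited. *)
Lemma good_cr_map S : good S -> good (cr_map S).
Proof.
move=> gS; have vS' := valid_cr_map gS; split=> // m.
apply: transient_of_monotone => [|y hy [p i]]; first exact: tridiag_ge0.
pose z l : 'cV[R]_n := \col_k y (inord l, k).
have zE (t : 'I_m.+1 * 'I_n) : z t.1 t.2 0 = y t by rewrite mxE inord_val; case: t.
have {}hy (t : 'I_m.+1 * 'I_n) :
    0 <= if interior m t.1 then residual (cr_map S) z t.1 t.2 0 else z t.1 t.2 0.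
  by rewrite -balance_tridiag (@balance_eq _ _ _ (@tridiag (cr_map S) m) _ (@dirichlet m) _ y).
have hz l k : (l <= m)%N -> ~~ interior m l -> 0 <= z l k 0.
  by move=> lm /negPf il; have := hy (inord l, k); rewrite /= inordK // il.
rewrite -zE /= -(refine_even S z p); apply: (@harmonic_ge0 S m.*2) => //.
- move=> l k; rewrite -(odd_double_half l); case: (odd l); rewrite ?add1n ?add0n.
    by move=> _; rewrite refine_odd // mxE.
  case: (l./2) => [|q]; first by rewrite /interior.
  rewrite /interior ltn_double => /andP[_ qm].
  rewrite -residual_double ?refine_odd //; last by rewrite -doubleS refine_odd.
  have := hy (inord q.+1, k); rewrite /= inordK; last exact: ltnW.
  rewrite /interior qm /= !residualS !doubleS -!doubleS !refine_even //.
- by move=> k; rewrite (refine_even S z 0) hz // /interior.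
- by move=> k; rewrite refine_even hz // /interior ltnn andbF.
- by rewrite leq_double -ltnS.
Qed.

Lemma good_iter S j : good S -> good (iter j cr_map S).
Proof. by move=> gS; elim: j => //= j; apply: good_cr_map. Qed.

Lemma harmonic_exists S j (a c : 'cV[R]_n) : good S ->
  exists x, [/\ harmonic S (2 ^ j) x, x 0%N = a & x (2 ^ j)%N = c].
Proof.
elim: j S => [|j IH] S gS.
  exists (fun l => if l == 0%N then a else c); split=> // l.
  by rewrite /interior; case: l => [|[]].
have [y [hy y0 ym]] := IH _ (good_cr_map gS).
exists (refine S y); rewrite expnS mul2n refine_even (refine_even S y 0); split=> // l.
rewrite -(odd_double_half l); case: (odd l); rewrite ?add1n ?add0n.
  by move=> _; rewrite refine_odd.
case: (l./2) => [|q]; first by rewrite /interior.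
rewrite /interior ltn_double => /andP[_ qm].
rewrite -residual_double ?refine_odd //; last by rewrite -doubleS refine_odd.
by rewrite -[RHS](hy q.+1) ?/interior ?qm // !residualS !doubleS -!doubleS !refine_even.
Qed.

(** After [j] steps the blocks [0] and [2 ^ j] are neighbours.  What block [0]
receives from its right in the original system, [C x_1], then splits into a
contribution [L] of block [0] to itself, accumulated in [Bhat] and [B], and the
contribution of block [2 ^ j], which is [C_j]; symmetrically for [A]. *)
Lemma transfer_matrices S j : good S -> exists L Q : 'M[R]_n,
  [/\ offdiag (stPhat (iter j cr_map S)) = offdiag (stPhat S) + offdiag L,
      offdiag (stP (iter j cr_map S)) = offdiag (stP S) + offdiag L + offdiag Q &
      forall x, harmonic S (2 ^ j) x ->
        stC S *m x 1%N = L *m x 0%N + stC (iter j cr_map S) *m x (2 ^ j)%N /\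
        stA S *m x (2 ^ j).-1 = stA (iter j cr_map S) *m x 0%N + Q *m x (2 ^ j)%N].
Proof.
elim: j S => [|j IH] S gS.
  have o0 : offdiag (0 : 'M[R]_n) = 0.
    by apply/matrixP => i k; rewrite !mxE; case: ifP.
  by exists 0, 0; rewrite o0 !addr0; split=> // x _; rewrite /= !mul0mx add0r addr0.
have [L [Q [hL hQ hx]]] := IH _ (good_cr_map gS).
exists (stC S *m solve_mx S (stA S) + L), (stA S *m solve_mx S (stC S) + Q); rewrite iterSr.
split=> [||x hS].
- by rewrite hL cr_mapPhat !offdiagD !offdiag_idem addrA.
- rewrite hQ cr_mapP !offdiagD !offdiag_idem.
  by apply/matrixP => i k; rewrite !mxE; ring.
have m0 : (0 < 2 ^ j)%N by rewrite expn_gt0.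
have [m mE] : exists m, (2 ^ j = m.+1)%N by exists (2 ^ j).-1; rewrite prednK.
move: hS hx; rewrite cr_mapC cr_mapA expnS mul2n mE doubleS /= => hS hx.
have solve q : (q.*2.+1 < m.*2.+2)%N ->
    x q.*2.+1 = solve_mx S (stA S) *m x q.*2 + solve_mx S (stC S) *m x q.*2.+2.
  move=> qm; have /eqP : residual S x q.*2.+1 = 0 by apply: hS; rewrite /interior qm.
  rewrite residualS -addrA -opprD subr_eq0 => /eqP h.
  by rewrite /solve_mx -!mulmxA -mulmxDr -h mulKmx // good_unit.
have [|e1 e2] := hx (fun l => x l.*2).
  move=> [|q]; rewrite /interior //= => qm.
  rewrite residual_double //; try by apply: hS; rewrite /interior; move: qm; lia.
have x1 : x 1%N = solve_mx S (stA S) *m x 0%N + solve_mx S (stC S) *m x 2%N by exact: (solve 0%N).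
have {}e1 : stC S *m solve_mx S (stC S) *m x 2%N =
  L *m x 0%N + stC (iter j cr_map (cr_map S)) *m x m.+1.*2 by exact: e1.
rewrite x1 (solve m) // !mulmxDr !mulmxDl -!doubleS.
rewrite !(mulmxA (stC S) (solve_mx S _)) !(mulmxA (stA S) (solve_mx S _)) e1 {}e2.
by split; apply/matrixP => i k; rewrite !mxE; ring.
Qed.

End CyclicReductionTheory.

(** * Sensitivity of the iterates of cyclic reduction *)

Section Sensitivity.
Variables (R : realType) (n : nat).
Implicit Types (S : cr_state R n) (x y : nat -> 'cV[R]_n).

Definition near_mx (rho : R) e (M N : 'M[R]_n) : Prop :=
  forall i j, near rho e (M i j) (N i j).

Definition near_state (rho : R) e S' S : Prop :=
  [/\ near_mx rho e (stA S') (stA S), near_mx rho e (stP S') (stP S),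
      near_mx rho e (stPhat S') (stPhat S) & near_mx rho e (stC S') (stC S)].

Lemma near_state_exp (rho : R) m e S' S :
  near_state rho (m * e) S' S <-> near_state (rho ^+ m) e S' S.
Proof. by split; case=> *; split=> i j; apply/near_exp. Qed.

Section Fixed.
Variable rho : R.
Hypothesis rho_ge1 : 1 <= rho.

Lemma near_state_refl e S : valid_state S -> near_state rho e S S.
Proof.
by case=> A0 C0 [P0 _] [Q0 _]; split=> i j; apply: near_refl.
Qed.

Lemma near_state_trans e f S2 S1 S3 :
  near_state rho e S1 S2 -> near_state rho f S2 S3 -> near_state rho (e + f) S1 S3.
Proof.
by case=> a1 a2 a3 a4 [b1 b2 b3 b4]; split=> i j;
  apply: near_trans; eauto.
Qed.

Lemma near_state_valid e S' S : near_state rho e S' S -> valid_state S -> valid_state S'.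
Proof.
case=> nA nP nQ nC [A0 C0 [P0 dP] [Q0 dQ]].
have diag0 (M N : 'M[R]_n) : near_mx rho e M N -> offdiag N = N -> offdiag M = M.
  move=> nM dN; apply/matrixP => i j; rewrite mxE; case: eqP => // <-.
  apply/esym/eqP; rewrite (near_eq0 (nM i i)) -dN mxE eqxx //.
split; [| |split|split].
- by move=> i j; case: (nA i j).
- by move=> i j; case: (nC i j).
- by move=> i j; case: (nP i j).
- exact: diag0 dP.
- by move=> i j; case: (nQ i j).
- exact: diag0 dQ.
Qed.

Lemma near_tridiag e S' S m t s :
  near_state rho e S' S -> near rho e (tridiag S' t s) (@tridiag R n S m t s).
Proof.
case=> nA nP nQ nC; rewrite /tridiag; case: ifP => _; last exact: near_refl.
have scale (b : bool) a c : near rho e a c -> near rho e (b%:R * a) (b%:R * c).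
  by move=> ac; case: b; rewrite ?mul1r // !mul0r; apply: near_refl.
by apply: near_add; [apply: near_add|]; apply: scale.
Qed.

(** Closeness forces equal zero patterns. *)
Lemma near_good e S' S : near_state rho e S' S -> good S -> good S'.
Proof.
move=> nS [vS tr]; split=> [|m]; first exact: near_state_valid nS vS.
apply: (transient_near (rho := rho) (e := e) _ _ (tr m)) => [t s|t].
  exact: near_tridiag.
by apply: near_refl => //; exact: dirichlet_ge0.
Qed.

Lemma card_interior m :
  (0 < m)%N -> #|[set t : 'I_m.+1 * 'I_n | interior m t.1]| = (m.-1 * n)%N.
Proof.
move=> m0.
have -> : [set t : 'I_m.+1 * 'I_n | interior m t.1] =
    setX (~: [set ord0; ord_max]) [set: 'I_n].
  apply/setP => -[p i]; rewrite !inE /= andbT /interior lt0n negb_or.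
  by rewrite -!val_eqE /= ltn_neqAle -ltnS ltn_ord andbT.
rewrite cardsX cardsT card_ord cardsCs setCK card_ord cards2.
by rewrite -val_eqE /= eq_sym -lt0n m0; congr (_ * _)%N; lia.
Qed.

(** Only the rows of the [m.-1] interior blocks are perturbed. *)
Lemma harmonic_sensitivity S' S m x' x : (0 < m)%N -> good S -> near_state rho 1 S' S ->
  harmonic S m x -> harmonic S' m x' -> x' 0%N = x 0%N -> x' m = x m ->
  (forall i, 0 <= x 0%N i 0) -> (forall i, 0 <= x m i 0) ->
  forall l i, (l <= m)%N -> near rho (2 * (m.-1 * n)) (x' l i 0) (x l i 0).
Proof.
move=> m0 gS nS hx hx' e0 em x0 xm l i lm; have [vS tr] := gS.
have bd (p : 'I_m.+1) : ~~ interior m p -> p = 0%N :> nat \/ p = m :> nat.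
  by rewrite /interior; have := ltn_ord p; lia.
pose b (t : 'I_m.+1 * 'I_n) : R := if interior m t.1 then 0 else x t.1 t.2 0.
rewrite -card_interior //.
have nP t s : near rho 1 (tridiag S' t s) (@tridiag _ _ S m t s) by exact: near_tridiag.
have nw (t : 'I_m.+1 * 'I_n) : near rho 1 (dirichlet R t) (dirichlet R t).
  by apply: near_refl => //; exact: dirichlet_ge0.
have nb t : near rho 1 (b t) (b t).
  case: t => p k; apply: near_refl => //; rewrite /b /=; case: ifP => [//|/negbT/bd].
  by case=> ->.
have eqW t : t \notin [set t : 'I_m.+1 * 'I_n | interior m t.1] ->
    [/\ @tridiag _ _ S' m t =1 @tridiag _ _ S m t, dirichlet R t = dirichlet R t & b t = b t].
  by rewrite inE => /negPf it; split=> // s; rewrite /tridiag it.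
have gx : balance (@tridiag _ _ S m) (@dirichlet R n m) (fun t => x t.1 t.2 0) =1 b.
  by move=> t; rewrite balance_tridiag /b; case: ifP => // /hx ->; rewrite mxE.
have gx' : balance (@tridiag _ _ S' m) (@dirichlet R n m) (fun t => x' t.1 t.2 0) =1 b.
  move=> [p k]; rewrite balance_tridiag /b /=; case: ifP => [int|/negbT/bd]; last first.
    by case=> ->; rewrite ?e0 ?em.
  by rewrite hx' // mxE.
have := solution_near rho_ge1 nP nw nb eqW (tr m) gx gx' (inord l, i).
by rewrite /= inordK.
Qed.

Lemma mulmx_delta (M : 'M[R]_n) i j : (M *m delta_mx j (0 : 'I_1)) i 0 = M i j.
Proof.
rewrite mxE (bigD1 j) //= mxE !eqxx mulr1 big1 ?addr0 // => k /negPf kj.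
by rewrite mxE kj mulr0.
Qed.

(** The matrices of [transfer_matrices] are products of [A] or [C] with solutions of
the section of length [2 ^ j], whence one more factor [rho]. *)
Lemma cr_iter_sensitivity S' S j : good S -> near_state rho 1 S' S ->
  near_state rho (2 * ((2 ^ j).-1 * n) + 1) (iter j cr_map S') (iter j cr_map S).
Proof.
move=> gS nS; have gS' := near_good nS gS; set N := (2 * _)%N.
have [vS _] := gS; have [vS' _] := gS'; have [nA nP nQ nC] := nS.
have [vj _] := good_iter j gS; have [vj' _] := good_iter j gS'.
have [L [Q [hL hQ hx]]] := transfer_matrices j gS.
have [L' [Q' [hL' hQ' hx']]] := transfer_matrices j gS'.
have m0 : (0 < 2 ^ j)%N by rewrite expn_gt0.
have mul_near (M' M : 'M[R]_n) (v' v : 'cV[R]_n) i : near_mx rho 1 M' M ->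
    (forall k, near rho N (v' k 0) (v k 0)) -> near rho (N + 1) ((M' *m v') i 0) ((M *m v) i 0).
  by move=> nM nv; rewrite !mxE; apply: near_sum => // k _; rewrite addnC; apply: near_mul.
have delta_ge0 (k i : 'I_n) : 0 <= (delta_mx k 0 : 'cV[R]_n) i 0.
  by rewrite mxE ler0n.
(* A unit mass at one end of the block system probes one column of each transfer matrix. *)
have left i k : near rho (N + 1) (L' i k) (L i k) /\
    near rho (N + 1) (stA (iter j cr_map S') i k) (stA (iter j cr_map S) i k).
  have [x [h x0 xm]] := harmonic_exists j (delta_mx k 0) 0 gS.
  have [x' [h' x0' xm']] := harmonic_exists j (delta_mx k 0) 0 gS'.
  have nx := harmonic_sensitivity m0 gS nS h h'.
  rewrite x0 x0' xm xm' in nx.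
  have {}nx l q : (l <= 2 ^ j)%N -> near rho N (x' l q 0) (x l q 0).
    by apply: nx => // p; rewrite mxE.
  have [e1 e2] := hx x h; have [e1' e2'] := hx' x' h'.
  move: e1 e2 e1' e2'; rewrite x0 x0' xm xm' !mulmx0 !addr0 => e1 e2 e1' e2'.
  split; rewrite -[X in near _ _ X]mulmx_delta -[X in near _ _ _ X]mulmx_delta.
    by rewrite -e1 -e1'; apply: mul_near => // l; apply: nx.
  by rewrite -e2 -e2'; apply: mul_near => // l; apply: nx; apply: leq_pred.
have right i k : near rho (N + 1) (Q' i k) (Q i k) /\
    near rho (N + 1) (stC (iter j cr_map S') i k) (stC (iter j cr_map S) i k).
  have [x [h x0 xm]] := harmonic_exists j 0 (delta_mx k 0) gS.
  have [x' [h' x0' xm']] := harmonic_exists j 0 (delta_mx k 0) gS'.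
  have nx := harmonic_sensitivity m0 gS nS h h'.
  rewrite x0 x0' xm xm' in nx.
  have {}nx l q : (l <= 2 ^ j)%N -> near rho N (x' l q 0) (x l q 0).
    by apply: nx => // p; rewrite mxE.
  have [e1 e2] := hx x h; have [e1' e2'] := hx' x' h'.
  move: e1 e2 e1' e2'; rewrite x0 x0' xm xm' !mulmx0 !add0r => e1 e2 e1' e2'.
  split; rewrite -[X in near _ _ X]mulmx_delta -[X in near _ _ _ X]mulmx_delta.
    by rewrite -e2 -e2'; apply: mul_near => // l; apply: nx; apply: leq_pred.
  by rewrite -e1 -e1'; apply: mul_near => // l; apply: nx.
have off (M' M : 'M[R]_n) e : near_mx rho e M' M -> near_mx rho e (offdiag M') (offdiag M).
  by move=> nM i k; rewrite !mxE; case: eqP => // _; apply: near_refl.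
have weak (M' M : 'M[R]_n) : near_mx rho 1 M' M -> near_mx rho (N + 1) M' M.
  by move=> nM i k; apply: near_weaken (nM i k) => //; rewrite leq_addl.
case: vj => _ _ [_ dP] [_ dQ]; case: vj' => _ _ [_ dP'] [_ dQ'].
split=> i k.
- by case: (left i k).
- rewrite -dP -dP' hQ hQ' ![(_ + offdiag Q) _ _]mxE ![(_ + offdiag Q') _ _]mxE.
  rewrite ![(_ + offdiag L) _ _]mxE ![(_ + offdiag L') _ _]mxE.
  by apply: near_add => //; [apply: near_add => //|]; apply: off;
    [apply: weak | move=> a c; case: (left a c) | move=> a c; case: (right a c)].
- rewrite -dQ -dQ' hL hL' ![(_ + offdiag L) _ _]mxE ![(_ + offdiag L') _ _]mxE.
  by apply: near_add => //; apply: off; [apply: weak | move=> a c; case: (left a c)].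
- by case: (right i k).
Qed.

End Fixed.
End Sensitivity.

(** * Error of the floating-point iteration *)

Section FloatingStep.
Variables (R : realType) (u : R) (F : fl_arith u) (n : nat).
Hypothesis u_gt0 : 0 < u.
Hypothesis u_lt1 : u < 1.
Implicit Types (S : cr_state R n) (M N : 'M[R]_n).

Notation rho := (1 - u)^-1.
Notation num := (fl_num F).

Definition machine_state S : Prop :=
  [/\ machine_mx F (stA S), machine_mx F (stP S), machine_mx F (stPhat S) &
      machine_mx F (stC S)].

(** The terms account for the GTH algorithm, the rounded row sums given to it, the
matrix products, and the two additions that update [B]. *)
Definition step_err : nat := gth_err n + 2 * n * n + n + 2.

Definition fl_near e M' M : Prop := machine_mx F M' /\ near_mx rho e M' M.

Lemma fl_mulmx_near e M N' N : machine_mx F M -> nonneg_mx M -> fl_near e N' N ->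
  fl_near (e + n) (fl_mulmx F M N') (M *m N).
Proof.
move=> nM M0 [nN near_N]; have r1 := rho_ge1 u_gt0 u_lt1.
suff h i j : num (fl_mulmx F M N' i j) /\
    near rho (e + n) (fl_mulmx F M N' i j) ((M *m N) i j).
  by split=> i j; case: (h i j).
rewrite !mxE; have [|nr near_r] := @fl_sum_near _ _ F u_gt0 u_lt1 (e + 1) _ (enum 'I_n)
   (fun l => fl_mul F (M i l) (N' l j)) (fun l => M i l * N l j).
  move=> l; have [//|nm near_m] := fl_mul_near u_lt1 (nM i l) (nN l j) (M0 i l) _.
    by case: (near_N l j).
  split=> //; rewrite addnC; apply: (near_trans r1 near_m).
  by rewrite -[e]add0n; apply: near_mul => //; apply: near_refl.
split=> //; move: near_r; rewrite big_enum /= size_enum_ord -addnA add1n prednK //.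
by apply: leq_trans (ltn_ord i).
Qed.

Definition fl_row_sums S : 'cV[R]_n :=
  \col_i fl_sum F [seq fl_add F (stA S i j) (stC S i j) | j <- enum 'I_n].

Lemma fl_row_sums_near S i : valid_state S -> machine_state S ->
  num (fl_row_sums S i 0) /\ near rho n (fl_row_sums S i 0) (row_sums S i 0).
Proof.
move=> [A0 C0 _ _] [nA _ _ nC]; rewrite row_sumsE mxE.
have [|nr near_r] := @fl_sum_near _ _ F u_gt0 u_lt1 1 _ (enum 'I_n)
   (fun j => fl_add F (stA S i j) (stC S i j)) (fun j => stA S i j + stC S i j).
  by move=> l; apply: fl_add_near.
split=> //; move: near_r; rewrite big_enum /= size_enum_ord add1n prednK //.
by apply: leq_trans (ltn_ord i).
Qed.

Lemma fl_solve_near S M : good S -> machine_state S -> machine_mx F M -> nonneg_mx M ->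
  fl_near (gth_err n + 2 * n * n) (fl_solve F (stP S) (fl_row_sums S) M) (solve_mx S M).
Proof.
move=> gS mS nM M0; have r1 := rho_ge1 u_gt0 u_lt1.
have [vS _] := gS; have trS := good_transient gS; have [_ nP _ _] := mS.
have P0 := valid_P0 vS; have w0 := valid_w0 vS.
have hw i := fl_row_sums_near i vS mS.
have fw0 i : 0 <= fl_row_sums S i 0 by case: (hw i) => _ [].
have tr' : transient (stP S) ((fl_row_sums S)^~ 0).
  apply: (transient_near (rho := rho) (e := n) _ _ trS) => [i j|i].
    exact: near_refl.
  by case: (hw i).
suff h i j : num (fl_solve F (stP S) (fl_row_sums S) M i j) /\
    near rho (gth_err n + 2 * n * n) (fl_solve F (stP S) (fl_row_sums S) M i j) (solve_mx S M i j).
  by split=> i j; case: (h i j).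
have [x gx] := balance_solvable (fun i => M i j) P0 fw0 tr'.
have near_x : near rho (2 * n * n) (x i) (solve_mx S M i j).
  rewrite mulnC; apply/near_exp; rewrite -[X in (_ * X)%N]card_ord -cardsT.
  apply: (@solution_near _ _ _ (rhoX_ge1 r1 n) setT (stP S) (stP S) ((row_sums S)^~ 0)
    ((fl_row_sums S)^~ 0) (fun i => M i j) (fun i => M i j) (fun i => solve_mx S M i j) x) => //.
  - by move=> k l; apply: near_refl => //; apply: rhoX_ge1.
  - by move=> k; apply/near_exp; rewrite muln1; case: (hw k).
  - by move=> k; apply: near_refl => //; apply: rhoX_ge1.
  - by move=> k; rewrite inE.
  - exact: solve_mx_balance.
have [||||nx near_g] := @fl_gth_near _ _ F u_gt0 u_lt1 n
  (stP S) (fl_row_sums S) (col j M) x _ _ _ tr' _ i.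
- by move=> k l; split; [exact: nP | exact: P0].
- by move=> k; split=> //; case: (hw k).
- by move=> k; rewrite mxE; split; [exact: nM | exact: M0].
- by move=> k; rewrite gx mxE.
by rewrite mxE; split=> //; apply: (near_trans r1 near_g).
Qed.

Lemma fl_cr_map_near S : good S -> machine_state S ->
  machine_state (fl_cr_map F S) /\ near_state rho step_err (fl_cr_map F S) (cr_map S).
Proof.
move=> gS mS; have r1 := rho_ge1 u_gt0 u_lt1.
have [[A0 C0 [P0 _] [Q0 _]] _] := gS; have [nA nP nQ nC] := mS.
have XA := fl_solve_near gS mS nA A0; have XC := fl_solve_near gS mS nC C0.
have AXA := fl_mulmx_near nA A0 XA; have AXC := fl_mulmx_near nA A0 XC.
have CXA := fl_mulmx_near nC C0 XA; have CXC := fl_mulmx_near nC C0 XC.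
set e := (gth_err n + 2 * n * n + n)%N in AXA AXC CXA CXC.
have eE : step_err = (e + 2)%N by [].
have weak M' M : near_mx rho e M' M -> near_mx rho step_err M' M.
  by move=> h i j; apply: near_weaken (h i j) => //; rewrite eE leq_addr.
have -> : fl_cr_map F S = CRState
    (fl_mulmx F (stA S) (fl_solve F (stP S) (fl_row_sums S) (stA S)))
    (\matrix_(i, j) if i == j then 0 else fl_sum F [:: stP S i j;
       fl_mulmx F (stA S) (fl_solve F (stP S) (fl_row_sums S) (stC S)) i j;
       fl_mulmx F (stC S) (fl_solve F (stP S) (fl_row_sums S) (stA S)) i j])
    (\matrix_(i, j) if i == j then 0 else fl_add F (stPhat S i j)
       (fl_mulmx F (stC S) (fl_solve F (stP S) (fl_row_sums S) (stA S)) i j))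
    (fl_mulmx F (stC S) (fl_solve F (stP S) (fl_row_sums S) (stC S))).
  by case: S {gS mS A0 C0 P0 Q0 nA nP nQ nC XA XC AXA AXC CXA CXC weak}.
move: AXA AXC CXA CXC; set aa := fl_mulmx F _ _; set ac := fl_mulmx F _ _.
set ca := fl_mulmx F _ _; set cc := fl_mulmx F _ _.
move=> [naa AXA] [nac AXC] [nca CXA] [ncc CXC].
have hP i j : num (if i == j then 0 else fl_sum F [:: stP S i j; ac i j; ca i j]) /\
    near rho step_err (if i == j then 0 else fl_sum F [:: stP S i j; ac i j; ca i j])
      (stP (cr_map S) i j).
  rewrite cr_mapP offdiagE; case: eqP => _; first by split; [exact: fl_num0 | exact: near_refl].
  have [|nr near_r] := sum_by_near u_gt0 u_lt1 (fl_sumP F [:: stP S i j; ac i j; ca i j]).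
    move=> z; rewrite !inE => /or3P[] /eqP->.
    - by split; [exact: nP | exact: P0].
    - by split; [exact: nac | case: (AXC i j)].
    - by split; [exact: nca | case: (CXA i j)].
  split=> //; rewrite eE addnC; apply: (near_trans r1 near_r).
  rewrite !big_cons big_nil addr0 addrA.
  rewrite [(_ + stC S *m _) i j]mxE [(stP S + _) i j]mxE.
  apply: near_add; last exact: CXA.
  by apply: near_add; [apply: near_refl | exact: AXC].
have hQ i j : num (if i == j then 0 else fl_add F (stPhat S i j) (ca i j)) /\
    near rho step_err (if i == j then 0 else fl_add F (stPhat S i j) (ca i j))
      (stPhat (cr_map S) i j).
  rewrite cr_mapPhat offdiagE; case: eqP => _; first by split; [exact: fl_num0 | exact: near_refl].
  have ca0 : 0 <= ca i j by case: (CXA i j).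
  have [nr near_r] := fl_add_near u_lt1 (nQ i j) (nca i j) (Q0 i j) ca0.
  split=> //; apply: (@near_weaken _ _ r1 (1 + e)); first by rewrite eE addnC leq_add2l.
  apply: (near_trans r1 near_r); rewrite [(stPhat S + _) i j]mxE.
  by apply: near_add; [apply: near_refl | exact: CXA].
split; split.
- exact: naa.
- by move=> i j; rewrite /= mxE; case: (hP i j).
- by move=> i j; rewrite /= mxE; case: (hQ i j).
- exact: ncc.
- by rewrite cr_mapA; apply: weak.
- by move=> i j; rewrite /= mxE; case: (hP i j).
- by move=> i j; rewrite /= mxE; case: (hQ i j).
- by rewrite cr_mapC; apply: weak.
Qed.

(** Exponent of the error after [k] floating-point steps followed by [j] exact
ones.  The first of the [k] floating-point steps to be peeled off is the last one
performed; its error passes only through the [j] exact steps. *)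
Fixpoint iter_err (j k : nat) : nat :=
  if k is l.+1 then (step_err * (2 * ((2 ^ j).-1 * n) + 1) + iter_err j.+1 l)%N else 0%N.

(** Replaces the floating-point steps by exact ones, starting from the last. *)
Lemma fl_cr_iter_near S k : good S -> machine_state S ->
  [/\ good (iter k (fl_cr_map F) S), machine_state (iter k (fl_cr_map F) S) &
    forall j, near_state rho (iter_err j k)
      (iter j cr_map (iter k (fl_cr_map F) S)) (iter (j + k) cr_map S)].
Proof.
move=> gS mS; have r1 := rho_ge1 u_gt0 u_lt1; elim: k => [|k [gk mk IH]] /=.
  by split=> // j; rewrite addn0; apply: near_state_refl => //; case: (good_iter j gS).
have [mk' near_k] := fl_cr_map_near gk mk.
have gk' := near_good r1 near_k (good_cr_map gk).
split=> // j; apply: (near_state_trans r1 (S2 := iter j.+1 cr_map (iter k (fl_cr_map F) S))).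
  rewrite iterSr; apply/near_state_exp; apply: cr_iter_sensitivity.
  - exact: rhoX_ge1.
  - exact: good_cr_map.
  - by apply/near_state_exp; rewrite muln1.
by rewrite addnS -addSn; apply: IH.
Qed.

End FloatingStep.

(** * The initial state *)

Section InitialState.
Variables (R : realType) (n : nat) (A B C : 'M[R]_n).

Notation S0 := (CRState A (- offdiag B) (- offdiag B) C).

Lemma initial_valid : assumption_A4 A B C -> valid_state S0.
Proof.
case=> A0 C0 [s [P [P0 _ BE]]].
have H0 : nonneg_mx (- offdiag B).
  move=> i j; rewrite !mxE; case: eqP => [_|/eqP ij]; first by rewrite oppr0.
  by rewrite BE !mxE (negPf ij) mulr0n sub0r opprK.
have Hd : offdiag (- offdiag B) = - offdiag B.
  by apply/matrixP => i j; rewrite !mxE; case: eqP => // _; rewrite oppr0.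
by split.
Qed.

(** A walk to a boundary block, which exists by irreducibility, cannot leave a closed
set of interior unknowns as long as it stays inside the section, nor can it reach
the boundary. *)
Lemma initial_good : assumption_A4 A B C ->
  irreducible_mx (biinf_tridiag A B C) -> good S0.
Proof.
move=> hA4 irr; have vS := initial_valid hA4; split=> // m U cl.
apply/setP => -[p i]; rewrite inE; apply/negP => tU.
have int t : t \in U -> interior m t.1.
  move=> /cl[/eqP + _]; rewrite /dirichlet; case: (interior m t.1) => //.
  by rewrite oner_eq0.
have out t s : t \in U -> tridiag S0 t s != 0 -> s \in U.
  by move=> /cl[_ h]; apply: contraNT => /h->.
have [l [q [walk_q last_q _]]] := irr (Posz p, i) (Posz m, i).
have : exists2 t, t \in U & last (Posz p, i) q = (Posz t.1, t.2).
  elim: q p i tU walk_q {last_q} => [|y q IH] p i tU /=; first by exists (p, i).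
  case/andP => edge; suff [t tU' ->] : exists2 t, t \in U & y = (Posz t.1, t.2).
    by apply: IH; case: t tU'.
  have := int _ tU; rewrite /interior /= => /andP[p0 pm].
  move: edge; case: y => z k; rewrite /nz_edge /biinf_tridiag /=.
  have edgeE (r : nat) : (r <= m)%N -> tridiag S0 (p, i) (inord r, k) =
      (r == p)%:R * (- offdiag B) i k + (r == p.+1)%:R * C i k + (r == p.-1)%:R * A i k.
    by move=> rm; rewrite /tridiag /interior /= p0 pm /= -val_eqE /= inordK.
  case: (z =P Posz p) => [-> nB|_].
    have [<-|ik] := eqVneq i k; first by exists (p, i).
    exists (p, k) => //; apply: (out _ _ tU).
    rewrite -[p in (p, k)]inord_val edgeE ?(ltnW pm) // eqxx mul1r.
    have -> : (p == p.+1 :> nat) = false by lia.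
    have -> : (p == p.-1 :> nat) = false by lia.
    by rewrite !mul0r !addr0 !mxE (negPf ik).
  case: (z =P Posz p + 1) => [-> nC|_].
    exists (inord p.+1, k); last by rewrite /= inordK //; congr (_, _); lia.
    apply: (out _ _ tU); rewrite edgeE // eqxx mul1r.
    have -> : (p.+1 == p :> nat) = false by lia.
    have -> : (p.+1 == p.-1 :> nat) = false by lia.
    by rewrite !mul0r add0r addr0.
  case: (z =P Posz p - 1) => [-> nA|_]; last by rewrite eqxx.
  have pm1 : (p.-1 <= m)%N by apply: leq_trans (leq_pred p) (ltnW pm).
  exists (inord p.-1, k); last by rewrite /= inordK //; congr (_, _); lia.
  apply: (out _ _ tU); rewrite edgeE // eqxx mul1r.
  have -> : (p.-1 == p :> nat) = false by lia.
  have -> : (p.-1 == p.+1 :> nat) = false by lia.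
  by rewrite !mul0r !add0r.
case=> t /int; rewrite last_q => h [e _]; move: h; rewrite -e /interior ltnn andbF //.
Qed.

End InitialState.

(** * Comparison with the constants of the bound *)

Section Constants.
Variable R : realType.

(** That is, [gth_err n = 2/3 n^3 + 3 n^2 - 5/3 n]. *)
Lemma gth_errE n : (3 * gth_err n + 5 * n = 2 * n * n * n + 9 * n * n)%N.
Proof. by elim: n => [//|n IH] /=; lia. Qed.

Lemma step_err_le n : 2 * (step_err n)%:R <= psi R n + n%:R + 2.
Proof.
have h : (3 * (2 * step_err n) <= 2 * ((2 * n + 5) * (n + 2) * (n + 3)) + 3 * n + 6)%N.
  by have := gth_errE n; rewrite /step_err; nia.
have {h} : (3 * (2 * step_err n))%:R <=
    (2 * ((2 * n + 5) * (n + 2) * (n + 3)) + 3 * n + 6)%:R :> R by rewrite ler_nat.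
rewrite /psi !(natrD, natrM); lra.
Qed.

(** Each amplification exponent [2 n (2 ^ i - 1) + 1] is at most [2 n 2 ^ i], and
these bounds telescope. *)
Lemma iter_err_le n j k : (0 < n)%N ->
  (iter_err n j k + step_err n * (2 * n) * 2 ^ j <= step_err n * (2 * n) * 2 ^ (j + k))%N.
Proof.
move=> n0; elim: k j => [|k IH] j /=; first by rewrite addn0.
have -> : (j + k.+1 = j.+1 + k)%N by lia.
apply: leq_trans (IH j.+1); rewrite addnAC addnC leq_add2l -!mulnA -mulnDr.
rewrite leq_mul2l; apply/orP; right.
have : (0 < 2 ^ j)%N by rewrite expn_gt0.
rewrite expnS; case: (2 ^ j)%N => // q _ /=; nia.
Qed.

Lemma rho_expansion N : exists2 K : R, 0 <= K &
  forall u : R, 0 < u < 1 / 2 -> (1 - u)^-1 ^+ N - 1 <= N%:R * u + K * u ^+ 2.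
Proof.
elim: N => [|N [K K0 IH]].
  by exists 0 => // u _; rewrite expr0 subrr !mul0r addr0.
have N0 : 0 <= N%:R :> R by [].
exists (4 * K + 3 * N%:R + 2) => [|u hu]; first by lra.
have /andP[u0 u2] := hu; have {}IH := IH u hu.
have rle : (1 - u)^-1 <= 1 + u + 2 * u ^+ 2.
  rewrite -[_^-1]mul1r ler_pdivrMr; last by lra.
  have : 0 <= u ^+ 2 * (1 - 2 * u) by rewrite mulr_ge0 ?sqr_ge0 //; lra.
  by rewrite !expr2; nra.
have r0 : 0 <= (1 - u)^-1 by rewrite invr_ge0; lra.
rewrite exprS lerBlDr.
have h1 : (1 - u)^-1 ^+ N <= 1 + (N%:R * u + K * u ^+ 2) by lra.
apply: le_trans (ler_pM r0 (exprn_ge0 _ r0) rle h1) _.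
have u2_0 : 0 <= u ^+ 2 by exact: sqr_ge0.
have e1 : u ^+ 2 * u <= u ^+ 2 by rewrite ler_piMr //; lra.
have e2 : u ^+ 2 * u ^+ 2 <= u ^+ 2 by rewrite ler_piMr // expr2; nra.
have n1 : N%:R * (u ^+ 2 * u) <= N%:R * u ^+ 2 by rewrite ler_wpM2l.
have k1 : K * (u ^+ 2 * u) <= K * u ^+ 2 by rewrite ler_wpM2l.
have k2 : K * (u ^+ 2 * u ^+ 2) <= K * u ^+ 2 by rewrite ler_wpM2l.
have -> : (1 + u + 2 * u ^+ 2) * (1 + (N%:R * u + K * u ^+ 2)) =
  1 + (N%:R + 1) * u + (K + N%:R + 2) * u ^+ 2 + 2 * (N%:R * (u ^+ 2 * u))
  + K * (u ^+ 2 * u) + 2 * (K * (u ^+ 2 * u ^+ 2)) by rewrite !expr2; ring.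
rewrite -natr1; nra.
Qed.

End Constants.

Theorem lemma18 (R : realType) (n : nat) (A B C : 'M[R]_n)
    (hA4 : assumption_A4 A B C) (hA5 : assumption_A5 A B C)
    (hA6 : assumption_A6 A B C) (k : nat) :
  let S0 := CRState A (- offdiag B) (- offdiag B) C in
  exists K u0 : R, 0 < u0 /\
    forall u : R, 0 < u < u0 ->
    forall F : fl_arith u,
      machine_mx F A -> machine_mx F C -> machine_mx F (offdiag B) ->
      state_close (n%:R * 2 ^+ k * (psi R n + n%:R + 2) * u) (K * u ^+ 2)
        (iter k (fl_cr_map F) S0) (iter k cr_map S0).
Proof.
move=> S0; have [irr _] := hA6; have gS0 := initial_good hA4 irr.
have [[A0 C0 [P0 _] [Q0 _]] _] := good_iter k gS0.
have [K K0 hK] := rho_expansion R (iter_err n 0 k).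
pose Sk := iter k cr_map S0.
(* Any upper bound of the entries of S_k serves for the constant K. *)
pose total := \sum_i \sum_j (stA Sk i j + stP Sk i j + stPhat Sk i j + stC Sk i j).
have t0 i j : 0 <= stA Sk i j + stP Sk i j + stPhat Sk i j + stC Sk i j.
  by rewrite !addr_ge0.
have le_total i j : stA Sk i j + stP Sk i j + stPhat Sk i j + stC Sk i j <= total.
  rewrite /total (bigD1 i) //= (bigD1 j) //= -addrA lerDl addr_ge0 //.
    by rewrite sumr_ge0.
  by rewrite sumr_ge0 // => l _; rewrite sumr_ge0.
exists (K * total), (1 / 2); split=> [|u hu F nA nC nB]; first by rewrite divr_gt0.
have /andP[u0 u2] := hu; have u1 : u < 1 by lra.
have mS0 : machine_state F S0.
  by split=> //= i j; rewrite mxE; apply: fl_numN.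
have [_ _ /(_ 0%N)] := fl_cr_iter_near u0 u1 k gS0 mS0.
rewrite add0n /= -/Sk => -[hA hP hQ hC].
have close (M' M : 'M[R]_n) : near_mx (1 - u)^-1 (iter_err n 0 k) M' M ->
    (forall i j, M i j <= total) -> forall i j, `|M' i j - M i j| <=
      n%:R * 2 ^+ k * (psi R n + n%:R + 2) * u * M i j + K * total * u ^+ 2.
  move=> hM Mt i j; have n0 : (0 < n)%N by apply: leq_ltn_trans (ltn_ord i).
  have M0 : 0 <= M i j by case: (hM i j).
  apply: le_trans (near_dist (rho_ge1 u0 u1) (hM i j)) _.
  apply: le_trans (ler_wpM2r M0 (hK u hu)) _.
  rewrite mulrDl lerD //; last first.
    by rewrite mulrAC ler_wpM2r ?sqr_ge0 // ler_wpM2l.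
  rewrite ler_wpM2r // ler_wpM2r ?(ltW u0) //.
  have : (iter_err n 0 k)%:R <= (step_err n * (2 * n) * 2 ^ k)%:R :> R.
    rewrite ler_nat; apply: leq_trans (iter_err_le 0 k n0).
    exact: leq_addr.
  move/le_trans; apply; rewrite !natrM natrX.
  have -> : (step_err n)%:R * (2 * n%:R) * 2 ^+ k =
    n%:R * 2 ^+ k * (2 * (step_err n)%:R) :> R by ring.
  by rewrite ler_wpM2l ?step_err_le // mulr_ge0 // exprn_ge0.
have pos i j : [/\ 0 <= stA Sk i j, 0 <= stP Sk i j, 0 <= stPhat Sk i j & 0 <= stC Sk i j].
  by split; [exact: A0 | exact: P0 | exact: Q0 | exact: C0].
split; apply: close => // i j; have := le_total i j; have [] := pos i j; lra.
Qed.
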